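(* Let $d\ge1$ and let $K:\mathbb{R}_*^d\times\mathbb{R}_*^d\to[0,\infty)$ be continuous and symmetric, $K(x,y)=K(y,x)$. Suppose that there are $c_2\in(0,\infty)$, $\beta\in\mathbb{R}$ and $\gamma=(\gamma_1,\gamma_2),\lambda=(\lambda_1,\lambda_2)\in\mathbb{R}^2$ with $-\lambda_j\le\gamma_j+\lambda_j$ and $\gamma_j+\lambda_j\le1$ for $j=1,2$, such that for all $x,y\in\mathbb{R}_*^d$ with $|y|\le|x|$, $$K(x,y)\le c_2\begin{cases}|x|^{-\beta}|y|^{-\beta}, & |x|,|y|\le1,\\ |x|^{\gamma_1+\lambda_1}|y|^{-\lambda_1}, & |x|\ge1,\ |y|\le1,\\ |x|^{\gamma_2+\lambda_2}|y|^{-\lambda_2}, & |x|,|y|\ge1.\end{cases}$$ Suppose moreover that there are $c_1>0$, $\gamma_{\mathrm{gel}}\in(1,2)$ and $\lambda_{\mathrm{gel}}\in\mathbb{R}$ with $-\lambda_{\mathrm{gel}}\le\gamma_{\mathrm{gel}}+\lambda_{\mathrm{gel}}$ such that $$c_1\left(|x|^{\gamma_{\mathrm{gel}}+\lambda_{\mathrm{gel}}}|y|^{-\lambda_{\mathrm{gel}}}+|y|^{\gamma_{\mathrm{gel}}+\lambda_{\mathrm{gel}}}|x|^{-\lambda_{\mathrm{gel}}}\right)\le K(x,y)\qquad\text{for all }x,y\in\mathbb{R}_*^d.$$ Suppose that $f_0\in\mathcal{M}_+(\mathbb{R}_*^d)$ satisfies $\int_{\mathbb{R}_*^d}|x|f_0(dx)+\int_{\mathbb{R}_*^d}\omega(x)f_0(dx)<\infty$,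 and let $f:[0,\infty)\to\mathcal{M}_+(\mathbb{R}_*^d)$ be a weak solution to the coagulation equation with kernel $K$ and initial data $f_0$. If $\int_{\mathbb{R}_*^d}|x|f_0(dx)\ne0$, then gelation occurs in finite time: there exists $T_*\in(0,\infty)$ such that $$\int_{\mathbb{R}_*^d}|x|f(dx,t)<\int_{\mathbb{R}_*^d}|x|f_0(dx)\qquad\text{for all }t\ge T_*.$$
   Context: $\mathbb{R}_*^d=[0,\infty)^d\setminus\{0\}$ and $|x|=\sum_{j=1}^d|x_j|$. $\mathcal{M}_+(\mathbb{R}_*^d)$ is the set of positive Radon measures on $\mathbb{R}_*^d$; $\mathcal{M}_b(\mathbb{R}_*^d)$ is the space of signed bounded Radon measures, identified with the dual of $C_0(\mathbb{R}_*^d)$, the sup-norm closure of $C_c(\mathbb{R}_*^d)$. For a continuous $\omega\ge0$ and a measure $\mu$, $\omega\mu$ is the weighted measure $\omega(x)\mu(dx)$; $(\omega f)(\cdot,t)=\omega f(\cdot,t)$. For vectors, $a\le b$ means componentwise inequality. Weight: $\omega(x)=|x|^{\min(-\beta,-\lambda_1)}$ if $|x|\le1$, and $\omega(x)=|x|^{\max(\gamma_1+\lambda_1,\gamma_2+\lambda_2)}$ if $|x|>1$. Test functions: $C^1([0,\infty);C_c(\mathbb{R}_*^d))$ denotes the set of functions $\varphi:\mathbb{R}_*^d\times[0,\infty)\to\mathbb{R}$ such that for each fixed $x\in\mathbb{R}_*^d$ the function $\varphi(x,\cdot)$ is continuously differentiable, and $\varphi(\cdot,t)\in C_c(\mathbb{R}_*^d)$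 for all $t\in[0,\infty)$. Weak solution: Let $f_0\in\mathcal{M}_+(\mathbb{R}_*^d)$ with $\int|x|f_0(dx)+\int\omega(x)f_0(dx)<\infty$. A map $f:[0,\infty)\to\mathcal{M}_+(\mathbb{R}_*^d)$ is a weak solution with initial data $f_0$ if: (a) $f(\cdot,0)=f_0$; (b) $\omega f\in C([0,\infty);\mathcal{M}_b(\mathbb{R}_*^d))$ with $\mathcal{M}_b(\mathbb{R}_*^d)$ endowed with the weak*-topology; (c) $\sup_{s\in[0,t]}\int_{\mathbb{R}_*^d}\omega(x)f(dx,s)<\infty$ for all $t\ge0$; (d) $\int_{\mathbb{R}_*^d}x f(dx,t)\le\int_{\mathbb{R}_*^d}x f_0(dx)$ (componentwise) for all $t\ge0$; (e) for all $t\ge0$ and all $\varphi\in C^1([0,\infty);C_c(\mathbb{R}_*^d))$, $$\int\varphi(x,t)f(dx,t)-\int\varphi(x,0)f_0(dx)=\int_0^t\int f(dx,s)\partial_s\varphi(x,s)\,ds+\frac12\int_0^t\iint K(x,y)f(dx,s)f(dy,s)\left[\varphi(x+y,s)-\varphi(x,s)-\varphi(y,s)\right]ds,$$ all integrals being over $\mathbb{R}_*^d$. *)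

(* Defs.v *)
From HB Require Import structures.
From mathcomp Require Import all_boot all_order all_algebra.
From mathcomp Require Import all_classical all_reals all_analysis.
Set Implicit Arguments.
Unset Strict Implicit.
Unset Printing Implicit Defensive.
Import Order.TTheory GRing.Theory Num.Theory.
Import numFieldNormedType.Exports.
Local Open Scope classical_set_scope.
Local Open Scope ring_scope.

(* R^d with its Borel sigma-algebra. *)
Definition borelRd (R : realType) (d : nat) :=
  g_sigma_algebraType (@open 'rV[R]_d).

(* The size |x| of the paper: the l^1 norm (the library norm on row vectors is
   the sup norm). *)
Definition norm1 (R : realType) (d : nat) (x : 'rV[R]_d) : R :=
  \sum_(j < d) `|x ord0 j|.

Definition Rstar (R : realType) (d : nat) : set 'rV[R]_d :=
  [set x | (forall j, 0 <= x ord0 j) /\ x <> 0].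
Arguments Rstar : clear implicits.

(* M_+(R_*^d): Borel measures on R^d that are concentrated on R_*^d and finite
   on the compact subsets of R_*^d.  As R_*^d is locally compact and
   sigma-compact, regularity is automatic.  A measure in M_+(R_*^d) may have
   infinite total mass near the origin. *)
Definition radon_Rstar (R : realType) (d : nat)
    (mu : {measure set (borelRd R d) -> \bar R}) : Prop :=
  mu (~` Rstar R d) = 0%E /\
  forall A : set 'rV[R]_d, compact A -> A `<=` Rstar R d -> (mu A < +oo)%E.

(* Functions on R_*^d are total functions on R^d of which only the values on
   R_*^d matter. *)
Definition Cc_Rstar (R : realType) (d : nat) (g : 'rV[R]_d -> R) : Prop :=
  {within Rstar R d, continuous g} /\
  exists A : set 'rV[R]_d, [/\ compact A, A `<=` Rstar R d &
    forall x, Rstar R d x -> ~ A x -> g x = 0].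

Definition C0_Rstar (R : realType) (d : nat) (g : 'rV[R]_d -> R) : Prop :=
  forall e : R, 0 < e -> exists h : 'rV[R]_d -> R,
    Cc_Rstar h /\ forall x, Rstar R d x -> `|g x - h x| <= e.

Definition weight (R : realType) (d : nat)
    (beta gamma1 gamma2 lambda1 lambda2 : R) (x : 'rV[R]_d) : R :=
  if norm1 x <= 1 then norm1 x `^ Num.min (- beta) (- lambda1)
  else norm1 x `^ Num.max (gamma1 + lambda1) (gamma2 + lambda2).

(* [dphi] is the time derivative of [phi] on [0, +oo[, one-sided at 0. *)
Definition C1_halfline (R : realType) (phi dphi : R -> R) : Prop :=
  {within `[0, +oo[, continuous dphi} /\
  forall s : R, 0 <= s ->
    h^-1 * (phi (s + h) - phi s) @[h --> within (fun h : R => 0 <= s + h) 0^']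
      --> dphi s.

Definition test_function (R : realType) (d : nat)
    (phi dphi : 'rV[R]_d -> R -> R) : Prop :=
  (forall x, Rstar R d x -> C1_halfline (phi x) (dphi x)) /\
  (forall t : R, 0 <= t -> Cc_Rstar (phi ^~ t)).

Definition coag_incr (R : realType) (d : nat) (phi : 'rV[R]_d -> R -> R)
    (s : R) (x y : 'rV[R]_d) : R :=
  phi (x + y) s - phi x s - phi y s.

(* Both double integrals on the right-hand side of the weak formulation
   converge absolutely.  This does not hold for every test function, because
   the supports of the [phi ^~ s] need not be uniformly compact in [s]. *)
Definition terms_converge (R : realType) (d : nat)
    (K : 'rV[R]_d -> 'rV[R]_d -> R)
    (f : R -> {measure set (borelRd R d) -> \bar R}) (t : R)
    (phi dphi : 'rV[R]_d -> R -> R) : Prop :=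
  (\int[lebesgue_measure]_(s in `[0%R, t])
     \int[f s]_(x in Rstar R d) `|dphi x s|%:E < +oo)%E /\
  (\int[lebesgue_measure]_(s in `[0%R, t])
     \int[f s]_(x in Rstar R d) \int[f s]_(y in Rstar R d)
       `|K x y * coag_incr phi s x y|%:E < +oo)%E.

Definition weak_identity (R : realType) (d : nat)
    (K : 'rV[R]_d -> 'rV[R]_d -> R)
    (f0 : {measure set (borelRd R d) -> \bar R})
    (f : R -> {measure set (borelRd R d) -> \bar R}) (t : R)
    (phi dphi : 'rV[R]_d -> R -> R) : Prop :=
  \int[f t]_(x in Rstar R d) phi x t - \int[f0]_(x in Rstar R d) phi x 0 =
  \int[lebesgue_measure]_(s in `[0, t]) (\int[f s]_(x in Rstar R d) dphi x s) +
  2^-1 * \int[lebesgue_measure]_(s in `[0, t])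
    (\int[f s]_(x in Rstar R d) (\int[f s]_(y in Rstar R d)
       (K x y * coag_incr phi s x y))).

(* [f] is only relevant at nonnegative times.  Weak-* continuity of [w f] is
   continuity of its pairing with each [g] in C_0(R_*^d), where the integral of
   [g] against [w f] is that of [g w] against [f]. *)
Record weak_solution (R : realType) (d : nat)
    (K : 'rV[R]_d -> 'rV[R]_d -> R) (w : 'rV[R]_d -> R)
    (f0 : {measure set (borelRd R d) -> \bar R})
    (f : R -> {measure set (borelRd R d) -> \bar R}) : Prop := WeakSolution {
  ws_radon : forall t : R, 0 <= t -> radon_Rstar (f t);
  ws_init : forall A : set (borelRd R d), measurable A -> f 0 A = f0 A;
  ws_bounded : forall t : R, 0 <= t ->
    (\int[f t]_(x in Rstar R d) (w x)%:E < +oo)%E;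
  ws_continuous : forall g : 'rV[R]_d -> R, C0_Rstar g ->
    {within `[0, +oo[, continuous
      (fun t : R => \int[f t]_(x in Rstar R d) (g x * w x))};
  ws_sup : forall t : R, 0 <= t ->
    (ereal_sup [set \int[f s]_(x in Rstar R d) (w x)%:E | s in `[0%R, t]]
       < +oo)%E;
  ws_mass : forall t : R, 0 <= t -> forall j : 'I_d,
    (\int[f t]_(x in Rstar R d) (x ord0 j)%:E
       <= \int[f0]_(x in Rstar R d) (x ord0 j)%:E)%E;
  ws_weak : forall t : R, 0 <= t -> forall phi dphi : 'rV[R]_d -> R -> R,
    test_function phi dphi -> terms_converge K f t phi dphi ->
    weak_identity K f0 f t phi dphi
}.

(* Main.v *)
Require Import Defs.
From mathcomp Require Import all_boot all_order all_algebra.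
From mathcomp Require Import all_classical all_reals all_analysis.
From mathcomp Require Import measurable_realfun ring lra.
Set Implicit Arguments.
Unset Strict Implicit.
Unset Printing Implicit Defensive.
Import Order.TTheory GRing.Theory Num.Theory.
Import numFieldNormedType.Exports.
Local Open Scope classical_set_scope.
Local Open Scope ring_scope.

(** Write M for the initial mass and test the weak formulation with functions of
    the size |x| only.  A test profile phi that is subadditive on the positive
    half-line makes every coagulation increment
    phi(|x|+|y|) - phi(|x|) - phi(|y|) nonpositive, so its moment decreases in
    time, and it decreases by the amount that the increments dissipate.

    By the arithmetic-geometric mean inequality the lower bound on K gives
    K(x,y) >= c1 |x|^h |y|^h with h = gamma_gel / 2, and 1/2 < h < 1.  For
    phi(r) = min(r, A) two clusters larger than A dissipate A, hence, uniformly
    in t,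
      int_0^t (int_{|x| >= A} |x|^h f(dx,s))^2 ds <= 2 M / (c1 A)
    ([large_mass_dissipation]).  Splitting sizes dyadically, |x| is at most a sum
    over the scales A_k of A_k^(1-h) |x|^h up to constants; the squares
    A_k^(2-2h) of these weights times the bounds 1 / A_k decay geometrically
    because h > 1/2.  Young's inequality then bounds the time
    integral over [0, t] of the mass carried by sizes above a threshold e by
    t M / 4 plus a constant independent of t.

    The mass below e stays small: the tent profile that equals r up to e and
    vanishes beyond 2 e is subadditive, so its moment never exceeds the initial
    one, which is at most M / 4 for e small ([tent_moment_small]).  Altogether the
    time integral of the mass over [0, t] is at most t M / 2 + C
    ([time_cutoff_mass_le]).  Since the mass is nonincreasing
    ([mass_nonincreasing]), mass M at time t would force that integral to be
    t M, which is impossible for t > 2 C / M ([mass_eventually_lost]).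

    The profiles above are not compactly supported in the punctured orthant, so
    they are multiplied by cutoffs.  The upper bounds on K give
    K(x,y) <= c2 w(x) w(y), and the error made by the cutoff is controlled by
    the part of the w-moment that the cutoff misses, which tends to zero by
    dominated convergence ([coag_term_cutoff_le], [cvg_cutoff_defect]).  The two
    estimates that survive the limit are [moment_dissipation] and
    [moment_nonincreasing]. *)

(** * Integrals of arbitrary integrands *)
Lemma le_of_cvg_seq (R : realType) (u v : nat -> R) (l l' : R) :
  u n @[n --> \oo] --> l -> v n @[n --> \oo] --> l' ->
  (forall n, u n <= v n) -> l <= l'.
Proof. by move=> ul vl' uv; apply: (ler_cvg_to ul vl'); exact: nearW. Qed.

(** The integral is a difference of two suprema over simple functions, so it is
    monotone for integrands that need not be measurable.  The coagulation term
    is an iterated integral in y, x and s whose intermediate integrands are only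
    ever compared with explicit measurable bounds; the lemmas of this section
    are what makes such comparisons legitimate. *)
Section AnyIntegrand.
Context {d : measure_display} {T : measurableType d} {R : realType}.
Variable mu : {measure set T -> \bar R}.
Implicit Types (A B D : set T) (f g : T -> \bar R).
Local Open Scope ereal_scope.

Lemma ge0_le_integral_any D f g : (forall x, D x -> 0 <= f x) ->
  (forall x, D x -> f x <= g x) ->
  \int[mu]_(x in D) f x <= \int[mu]_(x in D) g x.
Proof.
move=> f0 fg; rewrite !ge0_integralE//; last first.
  by move=> x Dx; exact: le_trans (f0 x Dx) (fg x Dx).
apply: ereal_sup_le => _ [h /= hf <-]; exists h => //= x.
apply: le_trans (hf x) _; rewrite /patch; case: ifPn => // xD.
exact/fg/set_mem.
Qed.

Lemma le_integral_any D f g : (forall x, D x -> f x <= g x) ->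
  \int[mu]_(x in D) f x <= \int[mu]_(x in D) g x.
Proof.
move=> fg; rewrite (integralE _ _ f) (integralE _ _ g); apply: leeB.
  apply: ge0_le_integral_any => x Dx; first exact: funepos_ge0.
  by rewrite !funeposE ge_max !le_max fg//= lexx orbT.
apply: ge0_le_integral_any => x Dx; first exact: funeneg_ge0.
by rewrite !funenegE ge_max !le_max leeN2 fg//= lexx orbT.
Qed.

Lemma ge0_subset_integral_any A B f : A `<=` B -> (forall x, B x -> 0 <= f x) ->
  \int[mu]_(x in A) f x <= \int[mu]_(x in B) f x.
Proof.
move=> AB f0; rewrite integral_mkcond [leRHS]integral_mkcond.
apply: le_integral_any => x _; rewrite /patch.
case: ifPn => [/set_mem/AB/mem_set -> //|_]; case: ifPn => // /set_mem.
exact: f0.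
Qed.

Lemma dominated_fin_num D (f h : T -> R) :
  (forall x, D x -> (`|f x| <= h x)%R) -> \int[mu]_(x in D) (h x)%:E < +oo ->
  \int[mu]_(x in D) (f x)%:E \is a fin_num.
Proof.
move=> fh hoo.
have h0 x : D x -> (0 <= h x)%R by move=> /fh; exact: le_trans.
rewrite fin_numE; apply/andP; split; apply/eqP => fE.
  have : \int[mu]_(x in D) (- (h x)%:E) <= \int[mu]_(x in D) (f x)%:E.
    by apply: le_integral_any => x /fh; rewrite -EFinN lee_fin ler_norml => /andP[].
  rewrite integral_ge0N//; rewrite fE leeNy_eq eqe_oppLR => /eqP hE.
  by rewrite hE ltxx in hoo.
have : \int[mu]_(x in D) (f x)%:E <= \int[mu]_(x in D) (h x)%:E.
  by apply: le_integral_any => x /fh; rewrite lee_fin ler_norml => /andP[].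
by rewrite fE leye_eq => /eqP hE; rewrite hE ltxx in hoo.
Qed.

(** The positive part of [f] is at most [g] on [B], while the integral of its
    negative part can only grow from [A] to [B].  Used for the increment of the
    time integral of the coagulation term between two times. *)
Lemma integral_sub_le_any A B f g : A `<=` B ->
  (forall x, B x -> f x <= g x) -> (forall x, B x -> 0 <= g x) ->
  \int[mu]_(x in A) f x \is a fin_num ->
  \int[mu]_(x in B) f x <= \int[mu]_(x in A) f x + \int[mu]_(x in B) g x.
Proof.
move=> AB fg g0 Afin.
have hp : \int[mu]_(x in B) f^\+ x <= \int[mu]_(x in B) g x.
  apply: ge0_le_integral_any => x Bx; first exact: funepos_ge0.
  by rewrite funeposE ge_max fg// g0.
have hn : \int[mu]_(x in A) f^\- x <= \int[mu]_(x in B) f^\- x.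
  by apply: ge0_subset_integral_any => // x _; exact: funeneg_ge0.
have hA : - (\int[mu]_(x in A) f^\- x) <= \int[mu]_(x in A) f x.
  rewrite [leRHS]integralE -[leLHS]add0e leeD//.
  by apply: integral_ge0 => x _; exact: funepos_ge0.
rewrite [leLHS]integralE addeC; apply: leeD => //.
by apply: le_trans hA; rewrite leeN2.
Qed.

End AnyIntegrand.

Section RealIntegrals.
Context {d : measure_display} {T : measurableType d} {R : realType}.
Variable mu : {measure set T -> \bar R}.
Implicit Types (A B D : set T) (f g h : T -> R).

Lemma le_Rintegral_any D f g h :
  (forall x, D x -> f x <= g x) -> (forall x, D x -> `|f x| <= h x) ->
  (\int[mu]_(x in D) (h x)%:E < +oo)%E -> mu.-integrable D (EFin \o g) ->
  measurable D ->
  \int[mu]_(x in D) f x <= \int[mu]_(x in D) g x.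
Proof.
move=> fg fh hoo ig mD; apply: fine_le.
- exact: dominated_fin_num hoo.
- exact: integrable_fin_num.
- by apply: le_integral_any => x Dx; rewrite lee_fin fg.
Qed.

Lemma norm_Rintegral_le_any D f h : measurable D ->
  mu.-integrable D (EFin \o h) -> (forall x, D x -> `|f x| <= h x) ->
  `|\int[mu]_(x in D) f x| <= \int[mu]_(x in D) h x.
Proof.
move=> mD ih fh; have hoo : (\int[mu]_(x in D) (h x)%:E < +oo)%E.
  by rewrite ltey_eq integrable_fin_num.
have ffin := dominated_fin_num fh hoo.
have ihN : mu.-integrable D (EFin \o (fun x => -1 * h x)).
  rewrite (_ : _ \o _ = (fun x => (-1)%:E * (EFin \o h) x)%E); last first.
    by apply/funext => x; rewrite /= EFinM.
  exact: integrableZl.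
rewrite ler_norml -mulN1r -RintegralZl//; apply/andP; split.
  apply: fine_le => //; first exact: integrable_fin_num ihN.
  apply: le_integral_any => x /fh.
  by rewrite lee_fin mulN1r ler_norml => /andP[].
apply: fine_le => //; first exact: integrable_fin_num.
by apply: le_integral_any => x /fh; rewrite lee_fin ler_norml => /andP[].
Qed.

Lemma ge0_integrableR D h : measurable D -> measurable_fun D h ->
  (forall x, D x -> 0 <= h x) -> (\int[mu]_(x in D) (h x)%:E < +oo)%E ->
  mu.-integrable D (EFin \o h).
Proof.
move=> mD mh h0 hoo; apply/integrableP; split; first exact/measurable_EFinP.
rewrite (eq_integral (fun x => (h x)%:E))// => x /set_mem Dx /=.
by rewrite ger0_norm// h0.
Qed.

Lemma dominated_integrableR D f h : measurable D -> measurable_fun D f ->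
  mu.-integrable D (EFin \o h) -> (forall x, D x -> `|f x| <= h x) ->
  mu.-integrable D (EFin \o f).
Proof.
move=> mD mf ih fh; apply: le_integrable ih => //; first exact/measurable_EFinP.
by move=> x Dx /=; rewrite lee_fin (le_trans (fh x Dx))// ler_norm.
Qed.

Lemma dominated_cvgR D (f_ : nat -> T -> R) f h : measurable D ->
  (forall n, measurable_fun D (f_ n)) ->
  (forall x, D x -> f_ ^~ x @ \oo --> f x) ->
  mu.-integrable D (EFin \o h) -> (forall n x, D x -> `|f_ n x| <= h x) ->
  mu.-integrable D (EFin \o f) /\
  \int[mu]_(x in D) f_ n x @[n --> \oo] --> \int[mu]_(x in D) f x.
Proof.
move=> mD mf_ f_f ih fh.
have mf : measurable_fun D f by exact: measurable_fun_cvg f_f.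
have [] := @dominated_convergence _ _ _ mu D mD (fun n => EFin \o f_ n)
   (EFin \o f) (EFin \o h).
- by move=> n; exact/measurable_EFinP.
- exact/measurable_EFinP.
- apply: aeW => x Dx; apply: cvg_EFin; first exact: nearW.
  exact: f_f.
- exact: ih.
- by apply: aeW => x n Dx /=; rewrite lee_fin fh.
move=> if_ _ cf; split => //.
by apply: fine_cvg; rewrite fineK//; exact: integrable_fin_num.
Qed.

Lemma Rintegral_sum_ord D (F : nat -> T -> R) N : measurable D ->
  (forall k, mu.-integrable D (EFin \o F k)) ->
  mu.-integrable D (EFin \o (fun x => \sum_(k < N) F k x)) /\
  \int[mu]_(x in D) (\sum_(k < N) F k x) = \sum_(k < N) \int[mu]_(x in D) F k x.
Proof.
move=> mD iF; elim: N => [|N [iN eN]].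
  rewrite big_ord0 (_ : (fun x => _) = cst 0); last first.
    by apply/funext => x; rewrite big_ord0.
  by split; [exact: integrable0|rewrite Rintegral_cst// mul0r].
rewrite (_ : (fun x => _) = (fun x => \sum_(k < N) F k x + F N x)); last first.
  by apply/funext => x; rewrite big_ord_recr.
split; first by apply: (integrableD mD iN (iF N)).
by rewrite RintegralD// eN big_ord_recr.
Qed.

End RealIntegrals.

(** * Functions of the size on the punctured orthant *)
Lemma continuous_powR_gt0 (R : realType) (p r : R) : 0 < r ->
  {for r, continuous (fun x : R => x `^ p)}.
Proof.
move=> r0; apply: differentiable_continuous; apply/derivable1_diffP.
by apply: derivable_powR; rewrite in_itv /= r0.
Qed.

(** Regularity of a profile away from the origin, which is all that is seen on
    the punctured orthant. *)
Definition continuous_pos (R : realType) (q : R -> R) :=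
  forall r, 0 < r -> {for r, continuous q}.

Section Radial.
Variables (R : realType) (d : nat).
Implicit Types x y : 'rV[R]_d.

Lemma norm1_ge0 x : 0 <= norm1 x.
Proof. exact: sumr_ge0. Qed.

(** Nonvanishing of [x] is only ever used through its size. *)
Lemma RstarE x : Rstar R d x <-> (forall j, 0 <= x ord0 j) /\ 0 < norm1 x.
Proof.
split=> -[x_ge0 x0]; split=> //.
  rewrite lt_neqAle norm1_ge0 andbT eq_sym.
  apply/eqP; rewrite /norm1 => /eqP; rewrite psumr_eq0// => /allP h.
  apply: x0; apply/funext => i; apply/funext => j; rewrite ord1.
  by apply/eqP; rewrite -normr_eq0; have := h j (mem_index_enum j).
move=> xE; move: x0; rewrite /norm1 big1 ?ltxx// => j _.
by rewrite xE /= normr0.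
Qed.

Lemma norm1_gt0 x : Rstar R d x -> 0 < norm1 x.
Proof. by case/RstarE. Qed.

Lemma norm1D x y : Rstar R d x -> Rstar R d y -> norm1 (x + y) = norm1 x + norm1 y.
Proof.
move=> [x0 _] [y0 _]; rewrite -big_split; apply: eq_bigr => j _ /=.
by rewrite mxE !ger0_norm// addr_ge0.
Qed.

Lemma RstarD x y : Rstar R d x -> Rstar R d y -> Rstar R d (x + y).
Proof.
move=> xR yR; apply/RstarE; rewrite norm1D//; split => [j|].
  by rewrite mxE addr_ge0; [|case: xR|case: yR].
by rewrite addr_gt0// norm1_gt0.
Qed.

Lemma continuous_norm1 : continuous (@norm1 R d).
Proof.
apply: continuous_big => [|j _ x].
  by move=> x; exact: add_continuous.
apply: continuous_comp; first exact: coord_continuous.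
exact: norm_continuous.
Qed.

Lemma closed_orthant : closed [set x : 'rV[R]_d | forall j, 0 <= x ord0 j].
Proof.
rewrite (_ : mkset _ = \bigcap_(j in setT) [set x : 'rV[R]_d | 0 <= x ord0 j]).
  apply: closed_bigI => j _.
  apply: (@preimage_closed _ _ (fun x : 'rV[R]_d => x ord0 j) [set r | 0 <= r]).
    by move=> x _; exact: coord_continuous.
  exact: closed_ge.
by apply/seteqP; split => x h j //=; exact: h.
Qed.

Lemma closed_norm1_preimage (A : set R) : closed A ->
  closed [set x : 'rV[R]_d | A (norm1 x)].
Proof.
apply: (@preimage_closed _ _ (@norm1 R d)) => x _; exact: continuous_norm1.
Qed.

Lemma open_measurable_borelRd (A : set (borelRd R d)) :
  @open 'rV[R]_d A -> measurable A.
Proof. exact: sub_sigma_algebra. Qed.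

Lemma closed_measurable_borelRd (A : set (borelRd R d)) :
  @closed 'rV[R]_d A -> measurable A.
Proof.
move=> cA; rewrite -(setCK A); apply: measurableC.
by apply: open_measurable_borelRd; exact: closed_openC.
Qed.

Lemma measurable_Rstar : measurable (Rstar R d : set (borelRd R d)).
Proof.
rewrite (_ : Rstar R d = [set x : 'rV[R]_d | forall j, 0 <= x ord0 j] `\`
    [set x | norm1 x <= 0]).
  apply: measurableD; apply: closed_measurable_borelRd.
    exact: closed_orthant.
  exact: (closed_norm1_preimage (@closed_le R 0)).
apply/seteqP; split => x /= => [/RstarE[x0 xp]|[x0 /negP]].
  by split=> //; apply/negP; rewrite -ltNge.
by rewrite -ltNge => xp; apply/RstarE.
Qed.

Lemma continuous_measurable_borelRd (g : 'rV[R]_d -> R) : continuous g ->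
  measurable_fun setT (g : borelRd R d -> R).
Proof.
move=> cg; apply: (measurability _ (RGenOpens.measurableE R)).
move=> _ [_ [a [b ->] <-]]; rewrite setTI; apply: open_measurable_borelRd.
by apply: open_comp; [move=> x _; exact: cg|exact: interval_open].
Qed.

Lemma measurable_norm1 : measurable_fun setT (@norm1 R d : borelRd R d -> R).
Proof. by apply: continuous_measurable_borelRd; exact: continuous_norm1. Qed.

Lemma measurable_radial (q : R -> R) : continuous_pos q ->
  measurable_fun (Rstar R d : set (borelRd R d)) (fun x => q (norm1 x)).
Proof.
move=> cq; apply: (@measurable_comp _ _ _ (borelRd R d) R R `]0, +oo[%classic q
  (Rstar R d) (@norm1 R d)).
- exact: measurable_itv.
- by move=> _ [x /norm1_gt0 x0 <-]; rewrite /= in_itv/= x0.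
- apply: open_continuous_measurable_fun; first exact: interval_open.
  by move=> r; rewrite inE /= in_itv/= andbT => /cq.
- apply: measurable_funTS; exact: measurable_norm1.
Qed.

Lemma compact_annulus (a b : R) :
  compact [set x : 'rV[R]_d | (forall j, 0 <= x ord0 j) /\ a <= norm1 x <= b].
Proof.
apply: bounded_closed_compact.
  exists b; split; first exact: num_real.
  move=> c bc x /= [_ /andP[_ xb]]; apply: le_trans (ltW bc).
  apply: le_trans xb; rewrite /Num.norm /= mx_normrE.
  apply: bigmax_le => [|[i j] _ /=]; first exact: norm1_ge0.
  rewrite (ord1 i) /norm1 (bigD1 j)//= lerDl; exact: sumr_ge0.
rewrite (_ : mkset _ = [set x : 'rV[R]_d | forall j, 0 <= x ord0 j] `&`
    [set x | [set r | a <= r] (norm1 x)] `&` [set x | [set r | r <= b] (norm1 x)]).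
  apply: closedI; first apply: closedI.
  - exact: closed_orthant.
  - exact: closed_norm1_preimage (@closed_ge R a).
  - exact: closed_norm1_preimage (@closed_le R b).
apply/seteqP; split => x /=; first by case=> ? /andP[].
by case=> -[? -> ->].
Qed.

(** The sizes in a segment [[a, b]] with [0 < a] form a compact annulus that
    avoids the origin. *)
Lemma Cc_radial (q : R -> R) (a b : R) : 0 < a ->
  continuous_pos q ->
  (forall r, ~~ (a <= r <= b) -> q r = 0) ->
  Cc_Rstar (fun x : 'rV[R]_d => q (norm1 x)).
Proof.
move=> a0 cq q0; split.
  apply: continuous_in_subspaceT => x /set_mem xR.
  apply: continuous_comp; first exact: continuous_norm1.
  exact/cq/norm1_gt0.
exists [set x : 'rV[R]_d | (forall j, 0 <= x ord0 j) /\ a <= norm1 x <= b].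
split; first exact: compact_annulus.
  by move=> x /= [x0 /andP[ax _]]; apply/RstarE; split; last exact: lt_le_trans ax.
move=> x [x0 _] /= h; apply: q0; apply/negP => h'; exact: h.
Qed.

End Radial.

(** * Size profiles *)
Section Profiles.
Variable R : realType.
Implicit Types (r p q : R) (n : nat).

(** Both powers are 1 at [r = 1]; the product form makes the continuity there
    evident. *)
Definition radial_weight p q r := Num.min r 1 `^ p * Num.max r 1 `^ q.

Lemma weightE d (beta gamma1 gamma2 lambda1 lambda2 : R) (x : 'rV[R]_d) :
  weight beta gamma1 gamma2 lambda1 lambda2 x =
  radial_weight (Num.min (- beta) (- lambda1))
    (Num.max (gamma1 + lambda1) (gamma2 + lambda2)) (norm1 x).
Proof.
rewrite /weight /radial_weight; case: leP => h.
  by rewrite powR1 mulr1.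
by rewrite powR1 mul1r.
Qed.

Lemma radial_weight_gt0 p q r : 0 < r -> 0 < radial_weight p q r.
Proof.
by move=> r0; rewrite mulr_gt0// powR_gt0// ?lt_min ?lt_max ?r0 ?ltr01.
Qed.

Lemma continuous_radial_weight p q : continuous_pos (radial_weight p q).
Proof.
move=> r r0; apply: continuousM.
  apply: (@continuous_comp _ _ _ (fun r => Num.min r 1) (fun x => x `^ p)).
    by apply: continuous_min => //; exact: cst_continuous.
  by apply: continuous_powR_gt0; rewrite lt_min r0/=.
apply: (@continuous_comp _ _ _ (fun r => Num.max r 1) (fun x => x `^ q)).
  by apply: continuous_max => //; exact: cst_continuous.
by apply: continuous_powR_gt0; rewrite lt_max r0.
Qed.

Definition cutoff n r :=
  Num.max 0 (Num.min 1 (Num.min (n.+1%:R * r - 1) (n.+2%:R - r))).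

Lemma cutoff_ge0 n r : 0 <= cutoff n r.
Proof. by rewrite le_max lexx. Qed.

Lemma cutoff_le1 n r : cutoff n r <= 1.
Proof. by rewrite ge_max ler01 ge_min lexx. Qed.

Lemma continuous_cutoff n : continuous (cutoff n).
Proof.
move=> r; apply: (@continuous_max _ _ (cst 0)
  (fun r => Num.min 1 (Num.min (n.+1%:R * r - 1) (n.+2%:R - r)))).
  exact: cst_continuous.
apply: (@continuous_min _ _ (cst 1)
  (fun r => Num.min (n.+1%:R * r - 1) (n.+2%:R - r))).
  exact: cst_continuous.
apply: (@continuous_min _ _ (fun r => n.+1%:R * r - 1) (fun r => n.+2%:R - r)).
  apply: (@continuousB _ _ _ (fun r => n.+1%:R * r)); last exact: cst_continuous.
  by apply: continuousM => //; exact: cst_continuous.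
by apply: continuousB => //; exact: cst_continuous.
Qed.

Lemma cutoff_support n r : ~~ (n.+1%:R^-1 <= r <= n.+2%:R) -> cutoff n r = 0.
Proof.
rewrite negb_and -!ltNge => h; apply/max_idPl; rewrite ge_min.
apply/orP; right; rewrite ge_min; apply/orP.
case/orP: h => [h|h]; [left|right].
  by rewrite subr_le0 mulrC -ler_pdivlMr// mul1r ltW.
by rewrite subr_le0 ltW.
Qed.

Lemma cvg_cutoff r : 0 < r -> cutoff n r @[n --> \oo] --> (1 : R).
Proof.
move=> r0; apply: cvg_near_cst; near=> n.
have rn : r <= n%:R by near: n; exact: nbhs_infty_ger.
have irn : 2 / r <= n%:R by near: n; exact: nbhs_infty_ger.
apply/eqP; rewrite /cutoff (min_idPl _) ?(max_idPr _)//.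
rewrite le_min; apply/andP; split; last by rewrite -natr1 -natr1; lra.
by move: irn; rewrite ler_pdivrMr// -natr1; lra.
Unshelve. all: by end_near. Qed.

Lemma continuous_trunc A : continuous_pos (fun r => Num.min r A).
Proof.
move=> r _; apply: (@continuous_min _ _ idfun (cst A)); first exact: cvg_id.
exact: cst_continuous.
Qed.

Lemma trunc_subadd A r u : 0 < A -> 0 < r -> 0 < u ->
  Num.min (r + u) A <= Num.min r A + Num.min u A.
Proof.
move=> A0 r0 u0.
by case: (leP (r + u) A) => ?; case: (leP r A) => ?; case: (leP u A) => ?; lra.
Qed.

(** Continuous stand-in for the indicator of [[2 * A, +oo[]: it vanishes up to
    [A] and is 1 from [2 * A] on. *)
Definition ramp A r := Num.max 0 (Num.min 1 (r / A - 1)).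

Lemma ramp_ge0 A r : 0 <= ramp A r.
Proof. by rewrite le_max lexx. Qed.

Lemma ramp_le1 A r : ramp A r <= 1.
Proof. by rewrite ge_max ler01 ge_min lexx. Qed.

Lemma continuous_ramp A : continuous (ramp A).
Proof.
move=> r; apply: (@continuous_max _ _ (cst 0) (fun r => Num.min 1 (r / A - 1))).
  exact: cst_continuous.
apply: (@continuous_min _ _ (cst 1) (fun r => r / A - 1)).
  exact: cst_continuous.
apply: (@continuousB _ _ _ (fun r => r / A)); last exact: cst_continuous.
by apply: continuousM => //; exact: cst_continuous.
Qed.

Lemma ramp_eq0 A r : 0 < A -> r <= A -> ramp A r = 0.
Proof.
move=> A0 rA; apply/max_idPl; rewrite ge_min subr_le0 ler_pdivrMr// mul1r rA.
by rewrite orbT.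
Qed.

Lemma ramp_eq1 A r : 0 < A -> 2 * A <= r -> ramp A r = 1.
Proof.
move=> A0 rA; rewrite /ramp (min_idPl _) ?(max_idPr _)//.
by rewrite lerBrDr ler_pdivlMr//; lra.
Qed.

(** A profile that sees only sizes below [2 * e] and still equals [r] up to [e].
    It is subadditive, since two small clusters can only merge into one that
    counts less, so it measures a mass that never increases. *)
Definition tent e r := Num.max 0 (Num.min r (2 * e - r)).

Lemma continuous_tent e : continuous_pos (tent e).
Proof.
move=> r _; apply: (@continuous_max _ _ (cst 0) (fun r => Num.min r (2 * e - r))).
  exact: cst_continuous.
apply: (@continuous_min _ _ idfun (fun r => 2 * e - r)); first exact: cvg_id.
by apply: continuousB; [exact: cst_continuous|exact: cvg_id].
Qed.

Lemma tent_bound e r : 0 < e -> 0 < r -> 0 <= tent e r <= e.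
Proof.
move=> e0 r0; rewrite /tent le_max lexx /=.
by case: (leP r (2 * e - r)) => ?; case: (leP 0) => ?; lra.
Qed.

Lemma tent_le e r : 0 < r -> tent e r <= r.
Proof.
by move=> r0; rewrite /tent; case: (leP r (2 * e - r)) => ?; case: (leP 0) => ?; lra.
Qed.

Lemma tent_id e r : 0 < r -> r <= e -> r <= tent e r.
Proof.
move=> r0 re; rewrite /tent.
by case: (leP r (2 * e - r)) => ?; case: (leP 0) => ?; lra.
Qed.

Lemma tent_eq0 e r : 2 * e <= r -> tent e r = 0.
Proof. by move=> er; apply/max_idPl; rewrite ge_min subr_le0 er orbT. Qed.

Lemma tent_subadd e r u : 0 < e -> 0 < r -> 0 < u ->
  tent e (r + u) <= tent e r + tent e u.
Proof.
move=> e0 r0 u0; rewrite /tent ge_max.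
have h0 x : 0 <= Num.max 0 x :> R by rewrite le_max lexx.
have h1 x : x <= Num.max 0 x :> R by rewrite le_max lexx orbT.
rewrite addr_ge0//=.
have := h0 (Num.min r (2 * e - r)); have := h1 (Num.min r (2 * e - r)).
have := h0 (Num.min u (2 * e - u)); have := h1 (Num.min u (2 * e - u)).
case: (leP (r + u) (2 * e - (r + u))) => ?; case: (leP r (2 * e - r)) => ?;
  case: (leP u (2 * e - u)) => ?; lra.
Qed.

(** Halving makes [ramp (dyadic e k)] reach 1 at [e * 2 ^+ k], so that the ramps
    with [k < N] take over from [tent e] exactly where it stops being the
    identity. *)
Definition dyadic (e : R) (k : nat) : R := e * 2 ^+ k / 2.

Lemma dyadic_gt0 e k : 0 < e -> 0 < dyadic e k.
Proof. by move=> e0; rewrite divr_gt0// mulr_gt0// exprn_gt0. Qed.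

Lemma dyadicS e k : dyadic e k.+1 = 2 * dyadic e k.
Proof. by rewrite /dyadic exprS; field. Qed.

(** On the shell where the [k]-th ramp is 1 and [r <= 4 * dyadic e k], write
    r = r^(1-h) r^h and bound the first factor by its value at the outer end;
    every other term of the sum is nonnegative. *)
Lemma le_dyadic_sum h e N r : h <= 1 -> 0 < e -> 0 < r -> r <= dyadic e N.+1 ->
  r <= tent e r + \sum_(k < N) (4 * dyadic e k) `^ (1 - h) *
         (ramp (dyadic e k) r * r `^ h).
Proof.
move=> h1 e0 r0; elim: N => [|N IH] rN.
  rewrite big_ord0 addr0; apply: tent_id => //.
  by rewrite (le_trans rN)// /dyadic expr1; lra.
rewrite big_ord_recr/= addrA.
have [rN'|rN'] := leP r (dyadic e N.+1).
  apply: le_trans (IH rN') _; rewrite lerDl.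
  by rewrite mulr_ge0 ?powR_ge0// mulr_ge0 ?ramp_ge0 ?powR_ge0.
have A0 := dyadic_gt0 N e0.
rewrite (ramp_eq1 A0); last by rewrite -dyadicS ltW.
apply: (@le_trans _ _ ((4 * dyadic e N) `^ (1 - h) * (1 * r `^ h))).
  have {1}-> : r = r `^ (1 - h) * r `^ h.
    by rewrite -powRD ?subrK ?powRr1 ?ltW// gt_eqF ?implybT.
  rewrite mul1r ler_wpM2r ?powR_ge0//; apply: ge0_ler_powR.
  - by rewrite subr_ge0.
  - by rewrite nnegrE ltW.
  - by rewrite nnegrE mulr_ge0// ltW.
  - by apply: (le_trans rN); rewrite !dyadicS; lra.
rewrite lerDr addr_ge0//; first by case/andP: (tent_bound e0 r0).
by apply: sumr_ge0 => k _; rewrite !mulr_ge0 ?powR_ge0 ?ramp_ge0.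
Qed.

Lemma exists_dyadic_ge (e x : R) : 0 < e -> exists N, x <= dyadic e N.+1.
Proof.
move=> e0; have [N xN] : exists N : nat, x / e <= N%:R.
  have [N _ /(_ N (leqnn N))] := nbhs_infty_ger (x / e); by exists N.
exists N; rewrite /dyadic exprS.
have : x <= N%:R * e by rewrite -ler_pdivrMr.
have : (N%:R : R) <= 2 ^+ N by rewrite -natrX ler_nat ltnW// ltn_expl.
nra.
Qed.

(** The left side is proportional to A_k^(2-2h), with A_k = [dyadic e k], so its
    quotient by A_k is geometric with ratio 2^(1-2h), which is below 1 because
    [h] exceeds 1/2.  The ratio is written as a square so that one factor [p]
    can be given away in Young's inequality and the other one still sums. *)
Lemma dyadic_weight_sqr h e : 1 / 2 < h -> 0 < e ->
  exists p C : R, [/\ 0 < p < 1, 0 < C & forall k,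
    ((4 * dyadic e k) `^ (1 - h)) ^+ 2 = C * dyadic e k * p ^+ k * p ^+ k].
Proof.
move=> h12 e0; pose p : R := 2 `^ (1 / 2 - h).
exists p, (2 * (2 * e) `^ (2 - 2 * h) / e); split.
- rewrite powR_gt0//=; rewrite /p -[ltRHS](powRr0 2) /powR gt_eqF// ltr_expR.
  by rewrite ltr_pM2r ?ln_gt0 ?ltr1n//; lra.
- by rewrite !mulr_gt0 ?invr_gt0 ?powR_gt0 ?mulr_gt0.
move=> k; rewrite -powR_mulrn ?powR_ge0// -powRrM.
rewrite (_ : (1 - h) * 2%:R = 2 - 2 * h); last by ring.
rewrite (_ : 4 * dyadic e k = (2 * e) * 2 ^+ k); last by rewrite /dyadic; field.
rewrite powRM ?mulr_ge0 ?ltW// ?exprn_gt0//.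
have -> : (2 ^+ k : R) `^ (2 - 2 * h) = 2 ^+ k * (p ^+ k * p ^+ k).
  rewrite -!powR_mulrn ?powR_ge0// /p -!powRrM -!powRD;
    try by rewrite pnatr_eq0 implybT.
  by congr (_ `^ _); field.
by rewrite /dyadic; field; rewrite gt_eqF.
Qed.

Lemma sum_geometric_le p N : 0 <= p < 1 -> \sum_(k < N) p ^+ k <= (1 - p)^-1.
Proof.
move=> /andP[p0 p1]; have q0 : 0 < 1 - p by rewrite subr_gt0.
rewrite -div1r ler_pdivlMr// mulrC -opprB mulNr -subrX1 opprB.
by rewrite gerBl exprn_ge0.
Qed.

End Profiles.

(** * Radial moments of a measure *)
Section Moments.
Context {R : realType} {d : nat}.
Implicit Types (mu : {measure set (borelRd R d) -> \bar R}) (q h : R -> R).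

Definition moment mu q : R := \int[mu]_(x in Rstar R d) q (norm1 x).

Definition integrable_radial mu q : Prop :=
  mu.-integrable (Rstar R d) (fun x => (q (norm1 x))%:E).

Lemma integrable_radial_le mu q h : continuous_pos q -> integrable_radial mu h ->
  (forall r, 0 < r -> `|q r| <= h r) -> integrable_radial mu q.
Proof.
move=> cq ih qh.
apply: (@dominated_integrableR _ _ _ mu _ (fun x => q (norm1 x)) _ _ _ ih).
- exact: measurable_Rstar.
- exact: measurable_radial.
- by move=> x /norm1_gt0 /qh.
Qed.

Lemma integrable_radialP mu q : continuous_pos q -> (forall r, 0 < r -> 0 <= q r) ->
  (\int[mu]_(x in Rstar R d) (q (norm1 x))%:E < +oo)%E -> integrable_radial mu q.
Proof.
move=> cq q0 qoo; apply: (@ge0_integrableR _ _ _ mu _ (fun x => q (norm1 x)) _ _ _ qoo).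
- exact: measurable_Rstar.
- exact: measurable_radial.
- by move=> x /norm1_gt0 /q0.
Qed.

Lemma integrable_radialZ mu a q : integrable_radial mu q ->
  integrable_radial mu (fun r => a * q r).
Proof. by move=> iq; apply: (integrableZl _ a iq); exact: measurable_Rstar. Qed.

Lemma integrable_radialD mu q h : integrable_radial mu q ->
  integrable_radial mu h -> integrable_radial mu (fun r => q r + h r).
Proof. by move=> iq ih; apply: (integrableD _ iq ih); exact: measurable_Rstar. Qed.

Lemma integrable_radial_norm mu q : integrable_radial mu q ->
  integrable_radial mu (fun r => `|q r|).
Proof. by move=> iq; apply: (integrable_norm iq); exact: measurable_Rstar. Qed.

Lemma momentZ mu a q : integrable_radial mu q ->
  moment mu (fun r => a * q r) = a * moment mu q.
Proof. by move=> iq; apply: RintegralZl iq; exact: measurable_Rstar. Qed.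

Lemma momentD mu q h : integrable_radial mu q -> integrable_radial mu h ->
  moment mu (fun r => q r + h r) = moment mu q + moment mu h.
Proof. by move=> iq ih; apply: RintegralD iq ih; exact: measurable_Rstar. Qed.

Lemma le_moment mu q h : integrable_radial mu q -> integrable_radial mu h ->
  (forall r, 0 < r -> q r <= h r) -> moment mu q <= moment mu h.
Proof.
move=> iq ih qh; apply: (le_Rintegral _ iq ih); first exact: measurable_Rstar.
by move=> x /norm1_gt0 /qh.
Qed.

Lemma moment_ge0 mu q : (forall r, 0 < r -> 0 <= q r) -> 0 <= moment mu q.
Proof. by move=> q0; apply: Rintegral_ge0 => x /norm1_gt0 /q0. Qed.

Lemma EFin_moment mu q : integrable_radial mu q ->
  ((moment mu q)%:E = \int[mu]_(x in Rstar R d) (q (norm1 x))%:E)%E.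
Proof.
move=> iq; rewrite fineK//; apply: (integrable_fin_num _ iq).
exact: measurable_Rstar.
Qed.

Lemma integrable_radial_lty mu q : integrable_radial mu q ->
  (\int[mu]_(x in Rstar R d) (q (norm1 x))%:E < +oo)%E.
Proof. by move=> /EFin_moment <-; rewrite ltry. Qed.

Lemma continuous_posM q h : continuous_pos q -> continuous_pos h ->
  continuous_pos (fun r => q r * h r).
Proof. by move=> cq ch r r0; apply: continuousM; [exact: cq|exact: ch]. Qed.

Lemma continuous_pos_cutoff n q : continuous_pos q ->
  continuous_pos (fun r => cutoff n r * q r).
Proof. by apply: continuous_posM => r _; exact: continuous_cutoff. Qed.

Lemma cutoff_mul_le n q r : `|cutoff n r * q r| <= `|q r|.
Proof.
by rewrite normrM ger0_norm ?cutoff_ge0// ler_piMl// cutoff_le1.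
Qed.

Lemma integrable_radial_cutoff mu n q : continuous_pos q ->
  integrable_radial mu q -> integrable_radial mu (fun r => cutoff n r * q r).
Proof.
move=> cq iq; apply: integrable_radial_le (integrable_radial_norm iq) _.
  exact: continuous_pos_cutoff.
by move=> r _; exact: cutoff_mul_le.
Qed.

Lemma cvg_moment mu (q_ : nat -> R -> R) q h :
  (forall n, continuous_pos (q_ n)) -> integrable_radial mu h ->
  (forall n r, 0 < r -> `|q_ n r| <= h r) ->
  (forall r, 0 < r -> q_ n r @[n --> \oo] --> q r) ->
  moment mu (q_ n) @[n --> \oo] --> moment mu q.
Proof.
move=> cq ih qh q_q.
have [] // := @dominated_cvgR _ _ _ mu (Rstar R d) (fun n x => q_ n (norm1 x))
  (fun x => q (norm1 x)) (fun x => h (norm1 x)) _ _ _ ih.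
- exact: measurable_Rstar.
- by move=> n; exact: measurable_radial.
- by move=> x /norm1_gt0 /q_q.
- by move=> n x /norm1_gt0 /qh.
Qed.

Lemma cvg_moment_cutoff mu q : continuous_pos q -> integrable_radial mu q ->
  moment mu (fun r => cutoff n r * q r) @[n --> \oo] --> moment mu q.
Proof.
move=> cq iq; apply: cvg_moment (integrable_radial_norm iq) _ _.
- by move=> n; exact: continuous_pos_cutoff.
- by move=> n r _; exact: cutoff_mul_le.
- move=> r r0; rewrite -[X in _ --> X]mul1r; apply: cvgM; last exact: cvg_cst.
  exact: cvg_cutoff.
Qed.

End Moments.

(** * A priori estimates for a weak solution *)

(** The weight enters as a radial profile [W] whose product dominates the kernel:
    the bound on the moment of [W] over bounded times is then what makes every
    double integral against the kernel finite. *)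
Section WeakSolution.
Context {R : realType} {d : nat}.
Variables (K : 'rV[R]_d -> 'rV[R]_d -> R) (W : R -> R).
Variables (f0 : {measure set (borelRd R d) -> \bar R}).
Variables (f : R -> {measure set (borelRd R d) -> \bar R}).
Hypothesis W_gt0 : forall r, 0 < r -> 0 < W r.
Hypothesis W_cont : continuous_pos W.
Hypothesis f_sol : weak_solution K (fun x => W (norm1 x)) f0 f.
Hypothesis f0_mass : integrable_radial f0 idfun.

Local Notation leb := (@lebesgue_measure R).

Lemma continuous_pos_id : continuous_pos (@idfun R).
Proof. by move=> r _; exact: cvg_id. Qed.

Lemma integrable_weight s : 0 <= s -> integrable_radial (f s) W.
Proof.
move=> s0; apply: integrable_radialP => //; last exact: (ws_bounded f_sol).
by move=> r /W_gt0 /ltW.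
Qed.

Lemma integral_norm1E (mu : {measure set (borelRd R d) -> \bar R}) :
  (\int[mu]_(x in Rstar R d) (norm1 x)%:E =
   \sum_(j < d) \int[mu]_(x in Rstar R d) (x ord0 j)%:E)%E.
Proof.
rewrite -ge0_integral_sum.
- apply: eq_integral => x /set_mem[x0 _]; rewrite /norm1 sumEFin; congr _%:E.
  by apply: eq_bigr => j _; rewrite ger0_norm.
- exact: measurable_Rstar.
- move=> j; apply/measurable_EFinP; apply: measurable_funTS.
  by apply: continuous_measurable_borelRd; exact: coord_continuous.
- by move=> j x [x0 _]; rewrite lee_fin.
Qed.

Lemma mass_integral_le s : 0 <= s ->
  (\int[f s]_(x in Rstar R d) (norm1 x)%:E <= \int[f0]_(x in Rstar R d) (norm1 x)%:E)%E.
Proof.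
by move=> s0; rewrite !integral_norm1E; apply: lee_sum => j _; exact: (ws_mass f_sol).
Qed.

Lemma integrable_mass s : 0 <= s -> integrable_radial (f s) idfun.
Proof.
move=> s0; apply: integrable_radialP => //.
- exact: continuous_pos_id.
- by move=> r /ltW.
apply: le_lt_trans (mass_integral_le s0) _.
exact: (integrable_radial_lty f0_mass).
Qed.

Lemma weight_moment_bounded t : 0 <= t ->
  exists2 B, 0 <= B & forall s, 0 <= s <= t -> moment (f s) W <= B.
Proof.
move=> t0; have := ws_sup f_sol t0; set E := ereal_sup _ => Eoo.
have hE s : 0 <= s <= t -> ((moment (f s) W)%:E <= E)%E.
  move=> st; have s0 : 0 <= s by case/andP: st.
  rewrite EFin_moment; last exact: integrable_weight.
  by apply: ereal_sup_ubound; exists s => //=; rewrite in_itv.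
have W0 s : 0 <= moment (f s) W by apply: moment_ge0 => r /W_gt0 /ltW.
have Efin : E \is a fin_num.
  rewrite ge0_fin_numE//; apply: le_trans (hE 0 _); last by rewrite lexx.
  by rewrite lee_fin.
exists (fine E); last by move=> s /hE; rewrite -{1}(fineK Efin) lee_fin.
rewrite fine_ge0//; apply: le_trans (hE 0 _); last by rewrite lexx.
by rewrite lee_fin.
Qed.

(** The moment of [q] against [f s] is the pairing of the weighted measure with
    q / W, a compactly supported function, hence weak-* continuous in time. *)
Lemma continuous_moment q a b : 0 < a -> continuous_pos q ->
  (forall r, ~~ (a <= r <= b) -> q r = 0) ->
  {within `[0, +oo[, continuous (fun s => moment (f s) q)}.
Proof.
move=> a0 cq q0.
have hC : C0_Rstar (fun x : 'rV[R]_d => (q (norm1 x) / W (norm1 x))).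
  move=> e e0; exists (fun x : 'rV[R]_d => (q (norm1 x) / W (norm1 x))); split.
    apply: (@Cc_radial _ _ (fun r => q r / W r) a b) => //.
      apply: continuous_posM => // r r0; apply: continuousV; last exact: W_cont.
      by rewrite gt_eqF// W_gt0.
    by move=> r /q0 ->; rewrite mul0r.
  by move=> x _; rewrite subrr normr0 ltW.
have := ws_continuous f_sol hC.
rewrite (_ : (fun t : R => _) = (fun s => moment (f s) q))//.
apply/funext => s; apply: eq_Rintegral => x /set_mem /norm1_gt0 x0 /=.
by rewrite divfK// gt_eqF// W_gt0.
Qed.

Lemma continuous_moment_cutoff n q : continuous_pos q ->
  {within `[0, +oo[, continuous (fun s => moment (f s) (fun r => cutoff n r * q r))}.
Proof.
move=> cq; apply: (@continuous_moment _ n.+1%:R^-1 n.+2%:R).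
- by rewrite invr_gt0.
- exact: continuous_pos_cutoff.
- by move=> r /cutoff_support ->; rewrite mul0r.
Qed.

Lemma measurable_moment_cutoff (t : R) n q : continuous_pos q ->
  measurable_fun `[0, t]%classic (fun s => moment (f s) (fun r => cutoff n r * q r)).
Proof.
move=> cq.
have sub : `[0, t]%classic `<=` `[0, +oo[%classic.
  by move=> s /=; rewrite !in_itv/= => /andP[->].
have := continuous_subspaceW sub (@continuous_moment_cutoff n q cq).
by apply: subspace_continuous_measurable_fun; exact: measurable_itv.
Qed.

(** Pointwise in time, the moment is the limit of its cutoffs, which are
    continuous. *)
Lemma measurable_moment (t : R) q : continuous_pos q ->
  (forall s, 0 <= s <= t -> integrable_radial (f s) q) ->
  measurable_fun `[0, t]%classic (fun s => moment (f s) q).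
Proof.
move=> cq iq; apply: (@measurable_fun_cvg _ _ _ _
    (fun n s => moment (f s) (fun r => cutoff n r * q r))).
  by move=> n; exact: measurable_moment_cutoff.
move=> s; rewrite /= in_itv => st; apply: cvg_moment_cutoff => //; exact: iq.
Qed.

Lemma time_integrable (t B : R) (u : R -> R) : measurable_fun `[0, t]%classic u ->
  (forall s, 0 <= s <= t -> `|u s| <= B) ->
  leb.-integrable `[0, t]%classic (EFin \o u).
Proof.
move=> mu uB; apply: measurable_bounded_integrable => //.
- by rewrite /= lebesgue_measure_itv/= -EFinB; case: ifP => _; rewrite ltry.
- exists B; split; first exact: num_real.
  by move=> x Bx s; rewrite /= in_itv/= => /uB h; exact: le_trans (ltW Bx).
Qed.

Lemma time_integrable_moment (t B : R) q : continuous_pos q ->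
  (forall s, 0 <= s <= t -> integrable_radial (f s) q) ->
  (forall s, 0 <= s <= t -> `|moment (f s) q| <= B) ->
  leb.-integrable `[0, t]%classic (EFin \o (fun s => moment (f s) q)).
Proof. by move=> cq iq; apply: time_integrable; exact: measurable_moment. Qed.

Lemma cvg_time_moment (t B : R) q : continuous_pos q -> (forall r, 0 < r -> 0 <= q r) ->
  (forall s, 0 <= s <= t -> integrable_radial (f s) q) ->
  (forall s, 0 <= s <= t -> moment (f s) q <= B) ->
  \int[leb]_(s in `[0, t]) moment (f s) (fun r => cutoff n r * q r) @[n --> \oo]
    --> \int[leb]_(s in `[0, t]) moment (f s) q.
Proof.
move=> cq q0 iq qB.
have iM : leb.-integrable `[0, t]%classic (EFin \o (fun s => moment (f s) q)).
  apply: (@time_integrable_moment _ B) => // s st.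
  by rewrite ger0_norm ?qB// moment_ge0.
have [] // := @dominated_cvgR _ _ _ leb `[0, t]%classic
  (fun n s => moment (f s) (fun r => cutoff n r * q r))
  (fun s => moment (f s) q) _ _ _ _ iM.
- by move=> n; exact: measurable_moment_cutoff.
- move=> s; rewrite /= in_itv => st; apply: cvg_moment_cutoff => //; exact: iq.
- move=> n s; rewrite /= in_itv => st.
  rewrite ger0_norm; last first.
    by apply: moment_ge0 => r r0; rewrite mulr_ge0 ?cutoff_ge0 ?q0.
  apply: le_moment; [|exact: iq|].
    by apply: integrable_radial_cutoff => //; exact: iq.
  by move=> r r0; rewrite ler_piMl ?cutoff_le1 ?q0.
Qed.

Variable c : R.
Hypothesis c_ge0 : 0 <= c.
Hypothesis K_ge0 : forall x y, Rstar R d x -> Rstar R d y -> 0 <= K x y.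
Hypothesis K_le : forall x y, Rstar R d x -> Rstar R d y ->
  K x y <= c * (W (norm1 x) * W (norm1 y)).

Definition radial_incr q (x y : 'rV[R]_d) : R :=
  q (norm1 (x + y)) - q (norm1 x) - q (norm1 y).

Definition coag_term q s : R :=
  \int[f s]_(x in Rstar R d) (\int[f s]_(y in Rstar R d)
    (K x y * radial_incr q x y)).

Lemma norm_radial_incr_le q B x y : (forall r, 0 < r -> `|q r| <= B) ->
  Rstar R d x -> Rstar R d y ->
  `|K x y * radial_incr q x y| <= 3 * B * c * W (norm1 x) * W (norm1 y).
Proof.
move=> qB xR yR; have KW := K_le xR yR; have K0 := K_ge0 xR yR.
have := qB _ (norm1_gt0 xR); have := qB _ (norm1_gt0 yR).
have := qB _ (norm1_gt0 (RstarD xR yR)).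
rewrite /radial_incr normrM (ger0_norm K0).
set u := q _; set v := q _; set w := q _ => uB vB wB.
have uvw : `|u - w - v| <= 3 * B.
  apply: le_trans (ler_normB _ _) _.
  have := ler_normB u w; lra.
have B0 : 0 <= 3 * B by apply: le_trans uvw.
rewrite -!mulrA mulrA mulrC; exact: ler_pM.
Qed.

Lemma norm_coag_inner_le q B s x : 0 <= s -> (forall r, 0 < r -> `|q r| <= B) ->
  Rstar R d x ->
  `|\int[f s]_(y in Rstar R d) (K x y * radial_incr q x y)| <=
  3 * B * c * moment (f s) W * W (norm1 x).
Proof.
move=> s0 qB xR; have iW := integrable_weight s0.
rewrite mulrAC -momentZ//; apply: norm_Rintegral_le_any.
- exact: measurable_Rstar.
- exact: integrable_radialZ.
- by move=> y yR; exact: norm_radial_incr_le.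
Qed.

Lemma norm_coag_term_le q B s : 0 <= s -> (forall r, 0 < r -> `|q r| <= B) ->
  `|coag_term q s| <= 3 * B * c * moment (f s) W * moment (f s) W.
Proof.
move=> s0 qB; have iW := integrable_weight s0.
rewrite -momentZ//; apply: norm_Rintegral_le_any.
- exact: measurable_Rstar.
- exact: integrable_radialZ.
- by move=> x xR; exact: norm_coag_inner_le.
Qed.

Lemma norm_coag_term_bounded q B t : 0 <= t -> 0 <= B ->
  (forall r, 0 < r -> `|q r| <= B) ->
  exists C, forall s, 0 <= s <= t -> `|coag_term q s| <= C.
Proof.
move=> t0 B0 qB; have [S S0 WS] := weight_moment_bounded t0.
exists (3 * B * c * S * S) => s st; have s0 : 0 <= s by case/andP: st.
have W0 : 0 <= moment (f s) W by apply: moment_ge0 => r /W_gt0 /ltW.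
have BC : 0 <= 3 * B * c by rewrite !mulr_ge0.
apply: le_trans (norm_coag_term_le s0 qB) _.
by rewrite -!(mulrA (3 * B * c)) ler_wpM2l// ler_pM// WS.
Qed.

Lemma time_cst_lty (C t : R) :
  (\int[leb]_(s in `[0%R, t]) C%:E < +oo)%E.
Proof.
rewrite -[X in integral _ _ X]/(cst C%:E) integral_cst/=; last exact: measurable_itv.
by rewrite lebesgue_measure_itv/=; case: ifP => _; rewrite -?EFinB ?mule0 ltry.
Qed.

Lemma fin_num_time_coag_term q B u : 0 <= u -> 0 <= B ->
  (forall r, 0 < r -> `|q r| <= B) ->
  (\int[leb]_(s in `[0%R, u]) (coag_term q s)%:E)%E \is a fin_num.
Proof.
move=> u0 B0 qB; have [C hC] := norm_coag_term_bounded u0 B0 qB.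
apply: (@dominated_fin_num _ _ _ leb _ _ (cst C)).
  by move=> s; rewrite /= in_itv/= => /hC.
exact: time_cst_lty.
Qed.

(** A compactly supported bounded profile is an admissible test function, and
    the domination of the kernel by the weights makes the double integral
    converge, uniformly on bounded time intervals. *)
Lemma weak_identity_radial q a b B t : 0 <= t -> 0 < a -> continuous_pos q ->
  (forall r, ~~ (a <= r <= b) -> q r = 0) -> 0 <= B ->
  (forall r, 0 < r -> `|q r| <= B) ->
  moment (f t) q - moment f0 q =
  2^-1 * \int[leb]_(s in `[0, t]) coag_term q s.
Proof.
move=> t0 a0 cq q0 B0 qB.
suff : weak_identity K f0 f t (fun x _ => q (norm1 x)) (fun _ _ => 0).
  rewrite /weak_identity => ->; rewrite [X in X + _](_ : _ = 0) ?add0r//.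
  rewrite (@eq_Rintegral _ _ _ _ _ (cst 0)).
    by rewrite (@Rintegral_cst _ _ _ leb)// mul0r.
  move=> s _; rewrite (@Rintegral_cst _ _ _ (f s)) ?mul0r//.
  exact: measurable_Rstar.
apply: (ws_weak f_sol) => //.
- split=> [x xR|s s0]; last exact: Cc_radial q0.
  split; first exact: cst_continuous.
  move=> s s0; under eq_fun do rewrite subrr mulr0.
  exact: cvg_cst.
- split.
    rewrite integral0_eq// => s _; rewrite integral0_eq// => x _.
    by rewrite normr0.
  have [S S0 WS] := weight_moment_bounded t0.
  apply: (@le_lt_trans _ _
     (\int[leb]_(s in `[0%R, t]) (3 * B * c * S * S)%:E)%E).
    apply: le_integral_any => s; rewrite /= in_itv/= => st.
    have s0 : 0 <= s by case/andP: st.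
    have iW := integrable_weight s0.
    have W0 : 0 <= moment (f s) W by apply: moment_ge0 => r /W_gt0 /ltW.
    apply: (@le_trans _ _
      (\int[f s]_(x in Rstar R d) (3 * B * c * S * W (norm1 x))%:E)%E).
      apply: le_integral_any => x xR.
      apply: (@le_trans _ _ (\int[f s]_(y in Rstar R d)
          (3 * B * c * W (norm1 x) * W (norm1 y))%:E)%E).
        apply: le_integral_any => y yR; rewrite lee_fin.
        exact: norm_radial_incr_le.
      rewrite -(@EFin_moment _ _ (f s) (fun r => 3 * B * c * W (norm1 x) * W r)).
        rewrite momentZ// lee_fin mulrAC; apply: ler_wpM2r.
          exact/ltW/W_gt0/norm1_gt0.
        by apply: ler_wpM2l; [rewrite !mulr_ge0|exact: WS].
      exact: integrable_radialZ.
    rewrite -(@EFin_moment _ _ (f s) (fun r => 3 * B * c * S * W r)).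
      rewrite momentZ// lee_fin.
      by apply: ler_wpM2l; [rewrite !mulr_ge0|exact: WS].
    exact: integrable_radialZ.
  exact: time_cst_lty.
Qed.

(** As 0 <= phi <= B, replacing [phi] by its cutoff lowers the gain term and
    alters the two loss terms by at most B (1 - cutoff), at [x] and at [y].
    Multiplied by the kernel, hence by at most c W W, this error integrates to
    the moment of [W] times the part of that moment that the cutoff misses. *)
Lemma coag_term_cutoff_le phi g B a n s : 0 <= s -> 0 <= B ->
  (forall r, 0 < r -> 0 <= phi r <= B) -> integrable_radial (f s) g ->
  (forall x y, Rstar R d x -> Rstar R d y ->
    a * (g (norm1 x) * g (norm1 y)) <= - (K x y * radial_incr phi x y)) ->
  coag_term (fun r => cutoff n r * phi r) s <=
  - a * (moment (f s) g) ^+ 2 + 2 * c * B * moment (f s) W *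
    (moment (f s) W - moment (f s) (fun r => cutoff n r * W r)).
Proof.
move=> s0 B0 phiB ig ha; have iW := integrable_weight s0.
have iX := @integrable_radial_cutoff _ _ _ n _ W_cont iW.
set q := fun r => cutoff n r * phi r.
set G := moment _ g; set S := moment _ W.
set X := fun r => cutoff n r * W r in iX *; set A := moment _ X.
have qB r : 0 < r -> `|q r| <= B.
  move=> r0; apply: le_trans (cutoff_mul_le n phi r) _.
  by have /andP[p0 pB] := phiB r r0; rewrite ger0_norm.
have pw x y : Rstar R d x -> Rstar R d y -> K x y * radial_incr q x y <=
    - a * g (norm1 x) * g (norm1 y) +
    c * B * (W (norm1 x) * W (norm1 y)) *
      ((1 - cutoff n (norm1 x)) + (1 - cutoff n (norm1 y))).
  move=> xR yR; have KW := K_le xR yR; have K0 := K_ge0 xR yR.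
  have := ha x y xR yR.
  have := phiB _ (norm1_gt0 xR); have := phiB _ (norm1_gt0 yR).
  have := phiB _ (norm1_gt0 (RstarD xR yR)).
  rewrite /radial_incr /q.
  have := cutoff_ge0 n (norm1 (x + y)); have := cutoff_le1 n (norm1 (x + y)).
  have := cutoff_ge0 n (norm1 x); have := cutoff_le1 n (norm1 x).
  have := cutoff_ge0 n (norm1 y); have := cutoff_le1 n (norm1 y).
  set k := K x y in K0 KW *.
  move: (phi (norm1 (x + y))) (phi (norm1 x)) (phi (norm1 y)) => pxy px py.
  move: (cutoff n (norm1 (x + y))) (cutoff n (norm1 x)) (cutoff n (norm1 y)).
  move=> cxy cx cy cy1 cy0 cx1 cx0 cxy1 cxy0.
  move=> /andP[pxy0 pxyB] /andP[py0 pyB] /andP[px0 pxB] hk.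
  (* The cutoff profile against the profile itself, before weighting by [K]. *)
  have h1 : cxy * pxy - cx * px - cy * py <=
      (pxy - px - py) + B * ((1 - cx) + (1 - cy)) by nra.
  have h2 := ler_wpM2l K0 h1.
  have h3 : 0 <= B * ((1 - cx) + (1 - cy)) by nra.
  have h4 := ler_wpM2r h3 KW.
  apply: (le_trans h2); rewrite mulrDr; nra.
have inner x : Rstar R d x ->
    \int[f s]_(y in Rstar R d) (K x y * radial_incr q x y) <=
    (- a * G) * g (norm1 x) + ((c * B * (2 * S - A)) * W (norm1 x) +
      (- (c * B * S)) * X (norm1 x)).
  move=> xR; set r := norm1 x.
  have i1 : integrable_radial (f s) (fun u => (- a * g r) * g u).
    exact: integrable_radialZ.
  have i2 : integrable_radial (f s) (fun u => (c * B * W r * (2 - cutoff n r)) * W u).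
    exact: integrable_radialZ.
  have i3 : integrable_radial (f s) (fun u => (- (c * B * W r)) * X u).
    exact: integrable_radialZ.
  have i23 := integrable_radialD i2 i3.
  have -> : (- a * G) * g r + ((c * B * (2 * S - A)) * W r + (- (c * B * S)) * X r) =
      moment (f s) (fun u => (- a * g r) * g u +
        ((c * B * W r * (2 - cutoff n r)) * W u + (- (c * B * W r)) * X u)).
    by rewrite !momentD// !momentZ// -/G -/S -/A /X; ring.
  apply: (@le_Rintegral_any _ _ _ (f s) _ _ _
      (fun y => 3 * B * c * W (norm1 x) * W (norm1 y))).
  - by move=> y yR; apply: le_trans (pw x y xR yR) _; rewrite -/r /X; lra.
  - by move=> y yR; exact: norm_radial_incr_le.
  - have iW' := integrable_radialZ (3 * B * c * W (norm1 x)) iW.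
    exact: (integrable_radial_lty iW').
  - exact: (integrable_radialD i1 i23).
  - exact: measurable_Rstar.
have i1 := integrable_radialZ (- a * G) ig.
have i2 := integrable_radialZ (c * B * (2 * S - A)) iW.
have i3 := integrable_radialZ (- (c * B * S)) iX.
have i23 := integrable_radialD i2 i3.
have -> : - a * G ^+ 2 + 2 * c * B * S * (S - A) =
    moment (f s) (fun r => (- a * G) * g r + ((c * B * (2 * S - A)) * W r +
      (- (c * B * S)) * X r)).
  by rewrite !momentD// !momentZ// -/G -/S -/A; ring.
apply: (@le_Rintegral_any _ _ _ (f s) _ _ _
    (fun x => 3 * B * c * S * W (norm1 x))) => //.
- by move=> x xR; exact: norm_coag_inner_le.
- have iW' := integrable_radialZ (3 * B * c * S) iW.
  exact: (integrable_radial_lty iW').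
- exact: (integrable_radialD i1 i23).
- exact: measurable_Rstar.
Qed.

Lemma integrable_radial_sublinear q s : 0 <= s -> continuous_pos q ->
  (forall r, 0 < r -> 0 <= q r <= r) -> integrable_radial (f s) q.
Proof.
move=> s0 cq qr; apply: integrable_radial_le cq (integrable_mass s0) _.
by move=> r /qr /andP[q0 qr']; rewrite ger0_norm.
Qed.

Definition cutoff_defect n s :=
  moment (f s) W - moment (f s) (fun r => cutoff n r * W r).

Lemma cutoff_defect_ge0 n s : 0 <= s -> 0 <= cutoff_defect n s.
Proof.
move=> s0; have iW := integrable_weight s0; rewrite subr_ge0; apply: le_moment => //.
  exact: integrable_radial_cutoff.
by move=> r r0; rewrite ler_piMl ?cutoff_le1// ltW// W_gt0.
Qed.

Lemma integrable_time_weight t : 0 <= t ->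
  leb.-integrable `[0, t]%classic (EFin \o (fun s => moment (f s) W)).
Proof.
move=> t0; have [M M0 WM] := weight_moment_bounded t0.
apply: (@time_integrable_moment _ M) => // s st.
  by apply: integrable_weight; case/andP: st.
by rewrite ger0_norm ?WM// moment_ge0// => r /W_gt0 /ltW.
Qed.

Lemma integrable_time_cutoff_weight n t : 0 <= t ->
  leb.-integrable `[0, t]%classic
    (EFin \o (fun s => moment (f s) (fun r => cutoff n r * W r))).
Proof.
move=> t0; have [M M0 WM] := weight_moment_bounded t0.
apply: (@time_integrable_moment _ M).
- exact: continuous_pos_cutoff.
- move=> s /andP[s0 _]; apply: integrable_radial_cutoff => //.
  exact: integrable_weight.
- move=> s st; have s0 : 0 <= s by case/andP: st.
  rewrite ger0_norm.
    by apply: le_trans (WM s st); rewrite -subr_ge0; exact: cutoff_defect_ge0.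
  by apply: moment_ge0 => r r0; rewrite mulr_ge0 ?cutoff_ge0// ltW// W_gt0.
Qed.

Lemma integrable_time_cutoff_defect n t : 0 <= t ->
  leb.-integrable `[0, t]%classic (EFin \o cutoff_defect n).
Proof.
move=> t0; apply: (integrableB _ (integrable_time_weight t0)
   (integrable_time_cutoff_weight n t0)).
exact: measurable_itv.
Qed.

Lemma cvg_cutoff_defect t : 0 <= t ->
  \int[leb]_(s in `[0, t]) cutoff_defect n s @[n --> \oo] --> (0 : R).
Proof.
move=> t0; have [M M0 WM] := weight_moment_bounded t0.
rewrite -[X in _ --> X](subrr (\int[leb]_(s in `[0, t]) moment (f s) W)).
rewrite (_ : (fun n => _) = (fun n => \int[leb]_(s in `[0, t]) moment (f s) W -
    \int[leb]_(s in `[0, t]) moment (f s) (fun r => cutoff n r * W r))); last first.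
  apply/funext => n; apply: (@RintegralB _ _ _ leb `[0, t]%classic _ _ _
    (integrable_time_weight t0) (integrable_time_cutoff_weight n t0)).
  exact: measurable_itv.
apply: cvgB; first exact: cvg_cst.
apply: (@cvg_time_moment _ M) => //.
- by move=> r /W_gt0 /ltW.
- by move=> s /andP[s0 _]; exact: integrable_weight.
Qed.

Lemma integrable_time_sqr_moment n q t : continuous_pos q ->
  leb.-integrable `[0, t]%classic
    (EFin \o (fun s => moment (f s) (fun r => cutoff n r * q r) ^+ 2)).
Proof.
move=> cq; apply: continuous_compact_integrable; first exact: segment_compact.
have sub : `[0, t]%classic `<=` `[0, +oo[%classic.
  by move=> s /=; rewrite !in_itv/= => /andP[->].
have cG := continuous_subspaceW sub (@continuous_moment_cutoff n q cq).
by move=> s; apply: (continuousM (cG s) (cG s)).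
Qed.

Section TestProfile.
Variables (phi : R -> R) (B : R).
Hypothesis phi_cont : continuous_pos phi.
Hypothesis phi_bound : forall r, 0 < r -> 0 <= phi r <= B.
Hypothesis phi_sub : forall r, 0 < r -> phi r <= r.

Let phi_n n r := cutoff n r * phi r.

Let phi_n_cont n : continuous_pos (phi_n n).
Proof. exact: continuous_pos_cutoff. Qed.

Let B_ge0 : 0 <= B.
Proof. by have /andP[] := phi_bound (@ltr01 R); exact: le_trans. Qed.

Let phi_nB n r : 0 < r -> `|phi_n n r| <= B.
Proof.
move=> r0; apply: le_trans (cutoff_mul_le n phi r) _.
by have /andP[p0 pB] := phi_bound r0; rewrite ger0_norm.
Qed.

Let weak_phi_n n t : 0 <= t -> moment (f t) (phi_n n) - moment f0 (phi_n n) =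
  2^-1 * \int[leb]_(s in `[0, t]) coag_term (phi_n n) s.
Proof.
move=> t0; apply: (@weak_identity_radial _ n.+1%:R^-1 n.+2%:R B) => //.
- by move=> r /cutoff_support h; rewrite /phi_n h mul0r.
- exact: phi_nB.
Qed.

Let phi_integrable s : 0 <= s -> integrable_radial (f s) phi.
Proof.
move=> s0; apply: integrable_radial_sublinear => // r r0.
by rewrite phi_sub// andbT; case/andP: (phi_bound r0).
Qed.

Let phi_integrable0 : integrable_radial f0 phi.
Proof.
apply: integrable_radial_le phi_cont f0_mass _ => r r0.
by rewrite ger0_norm ?phi_sub//; case/andP: (phi_bound r0).
Qed.

(** Limit of the weak identity for the cutoffs of [phi]: the moment of [phi] loses
    at least half of the dissipation.  The lower bound [a * g * g] on
    the dissipation is a product so that its double integral is the square of a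
    moment, and [g] is cut off so that this moment is continuous in time. *)
Lemma moment_dissipation m g a t : 0 <= t -> continuous_pos g -> 0 <= a ->
  (forall s, 0 <= s -> integrable_radial (f s) g) ->
  (forall x y, Rstar R d x -> Rstar R d y ->
    a * ((cutoff m (norm1 x) * g (norm1 x)) * (cutoff m (norm1 y) * g (norm1 y)))
      <= - (K x y * radial_incr phi x y)) ->
  moment (f t) phi + 2^-1 * (a *
    \int[leb]_(s in `[0, t]) moment (f s) (fun r => cutoff m r * g r) ^+ 2)
  <= moment f0 phi.
Proof.
move=> t0 cg a0 ig ha; have [M M0 WM] := weight_moment_bounded t0.
set G := fun s => moment (f s) (fun r => cutoff m r * g r).
set J := \int[leb]_(s in _) _.
have iG := @integrable_time_sqr_moment m g t cg.
have step n : moment (f t) (phi_n n) + 2^-1 * (a * J) <= moment f0 (phi_n n) +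
    c * B * M * \int[leb]_(s in `[0, t]) cutoff_defect n s.
  rewrite -lerBlDl -addrAC weak_phi_n// -lerBrDr.
  have iD := integrable_time_cutoff_defect n t0.
  have i1 : leb.-integrable `[0, t]%classic (EFin \o (fun s => - a * G s ^+ 2)).
    by apply: (integrableZl _ (- a) iG); exact: measurable_itv.
  have i2 : leb.-integrable `[0, t]%classic
      (EFin \o (fun s => 2 * c * B * M * cutoff_defect n s)).
    by apply: (integrableZl _ (2 * c * B * M) iD); exact: measurable_itv.
  apply: (@le_trans _ _ (2^-1 * \int[leb]_(s in `[0, t])
      (- a * G s ^+ 2 + 2 * c * B * M * cutoff_defect n s))).
    rewrite ler_wpM2l// ?invr_ge0//.
    have [C hC] := @norm_coag_term_bounded (phi_n n) B t t0 B_ge0 (@phi_nB n).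
    apply: (@le_Rintegral_any _ _ _ leb _ _ _ (cst C)).
    - move=> s; rewrite /= in_itv/= => st; have s0 : 0 <= s by case/andP: st.
      apply: le_trans (@coag_term_cutoff_le phi (fun r => cutoff m r * g r) B a n s
        s0 B_ge0 phi_bound _ ha) _.
        by apply: integrable_radial_cutoff => //; exact: ig.
      rewrite lerD2l -/(cutoff_defect n s) ler_wpM2r ?cutoff_defect_ge0//.
      by rewrite ler_wpM2l ?WM// !mulr_ge0.
    - by move=> s; rewrite /= in_itv/= => /hC.
    - exact: time_cst_lty.
    - by apply: (integrableD _ i1 i2).
    - exact: measurable_itv.
  rewrite RintegralD//.
  rewrite (@RintegralZl _ _ _ leb _ _ _ _ iG); last exact: measurable_itv.
  rewrite (@RintegralZl _ _ _ leb _ _ _ _ iD); last exact: measurable_itv.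
  by rewrite -/J; lra.
apply: (@le_of_cvg_seq R
  (fun n => moment (f t) (phi_n n) + 2^-1 * (a * J))
  (fun n => moment f0 (phi_n n) +
    c * B * M * \int[leb]_(s in `[0, t]) cutoff_defect n s)).
- apply: cvgD; last exact: cvg_cst.
  by apply: cvg_moment_cutoff => //; exact: phi_integrable.
- rewrite -[moment f0 phi]addr0; apply: cvgD; first exact: cvg_moment_cutoff.
  rewrite -[X in _ --> X](mulr0 (c * B * M)); apply: cvgM; first exact: cvg_cst.
  exact: cvg_cutoff_defect.
- exact: step.
Qed.

(** Subtract the weak identities at times [t] and [s].  Up to the cutoff error,
    which vanishes in the limit, the coagulation term is nonpositive. *)
Lemma moment_nonincreasing s t : 0 <= s <= t ->
  (forall r u, 0 < r -> 0 < u -> phi (r + u) <= phi r + phi u) ->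
  moment (f t) phi <= moment (f s) phi.
Proof.
move=> /andP[s0 st] phi_subadd; have t0 : 0 <= t by exact: le_trans st.
have [M M0 WM] := weight_moment_bounded t0.
have step n : moment (f t) (phi_n n) <= moment (f s) (phi_n n) +
    2^-1 * (2 * c * B * M * \int[leb]_(s in `[0, t]) cutoff_defect n s).
  have -> : moment (f t) (phi_n n) = moment f0 (phi_n n) +
      2^-1 * \int[leb]_(s in `[0, t]) coag_term (phi_n n) s.
    by rewrite -weak_phi_n// addrC subrK.
  have -> : moment (f s) (phi_n n) = moment f0 (phi_n n) +
      2^-1 * \int[leb]_(s in `[0, s]) coag_term (phi_n n) s.
    by rewrite -weak_phi_n// addrC subrK.
  rewrite -addrA lerD2l -mulrDr ler_wpM2l// ?invr_ge0//.
  have iD := integrable_time_cutoff_defect n t0.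
  rewrite -(@RintegralZl _ _ _ leb _ _ _ _ iD); last exact: measurable_itv.
  have i2 : leb.-integrable `[0, t]%classic
      (EFin \o (fun s => 2 * c * B * M * cutoff_defect n s)).
    by apply: (integrableZl _ (2 * c * B * M) iD); exact: measurable_itv.
  have fs : (\int[leb]_(u in `[0%R, s]) (coag_term (phi_n n) u)%:E)%E \is a fin_num.
    by apply: (@fin_num_time_coag_term _ B) => //; exact: phi_nB.
  have ft : (\int[leb]_(u in `[0%R, t]) (coag_term (phi_n n) u)%:E)%E \is a fin_num.
    by apply: (@fin_num_time_coag_term _ B) => //; exact: phi_nB.
  have fD : (\int[leb]_(u in `[0%R, t])
      (2 * c * B * M * cutoff_defect n u)%:E)%E \is a fin_num.
    by apply: (integrable_fin_num _ i2).
  rewrite /Rintegral -fineD// fine_le//; first by rewrite fin_numD fs.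
  apply: integral_sub_le_any => //.
  - by move=> u /=; rewrite !in_itv/= => /andP[-> /le_trans ->].
  - move=> u; rewrite /= in_itv/= => ut; have u0 : 0 <= u by case/andP: ut.
    rewrite lee_fin.
    apply: le_trans (@coag_term_cutoff_le phi (cst 0) B 0 n u u0 B_ge0 phi_bound _ _) _.
    + apply: integrable_radial_sublinear => // r r0; first exact: cst_continuous.
      by rewrite /= lexx ltW.
    + move=> x y xR yR; rewrite mul0r -mulrN mulr_ge0 ?K_ge0// /radial_incr.
      rewrite norm1D//; have := phi_subadd _ _ (norm1_gt0 xR) (norm1_gt0 yR); lra.
    rewrite oppr0 mul0r add0r -/(cutoff_defect n u) ler_wpM2r ?cutoff_defect_ge0//.
    by rewrite ler_wpM2l ?WM// !mulr_ge0.
  - move=> u; rewrite /= in_itv/= => /andP[u0 _]; rewrite lee_fin.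
    by rewrite !mulr_ge0// cutoff_defect_ge0.
apply: (@le_of_cvg_seq R
  (fun n => moment (f t) (phi_n n))
  (fun n => moment (f s) (phi_n n) +
    2^-1 * (2 * c * B * M * \int[leb]_(s in `[0, t]) cutoff_defect n s))).
- by apply: cvg_moment_cutoff => //; exact: phi_integrable.
- rewrite -[moment (f s) phi]addr0; apply: cvgD.
    by apply: cvg_moment_cutoff => //; exact: phi_integrable.
  rewrite -[X in _ --> X](mulr0 2^-1); apply: cvgM; first exact: cvg_cst.
  rewrite -[X in _ --> X](mulr0 (2 * c * B * M)); apply: cvgM; first exact: cvg_cst.
  exact: cvg_cutoff_defect.
- exact: step.
Qed.

End TestProfile.

Lemma mass_moment_le s : 0 <= s -> moment (f s) idfun <= moment f0 idfun.
Proof.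
move=> s0; rewrite -lee_fin !EFin_moment//; last exact: integrable_mass.
exact: mass_integral_le.
Qed.

(** The mass is the increasing limit of the moments of the bounded subadditive
    profiles min(r, n). *)
Lemma mass_nonincreasing s t : 0 <= s <= t ->
  moment (f t) idfun <= moment (f s) idfun.
Proof.
move=> st; have s0 : 0 <= s by case/andP: st.
have t0 : 0 <= t by case/andP: st => _; exact: le_trans.
have cvg_trunc u : 0 <= u -> moment (f u) (fun r => Num.min r n.+1%:R) @[n --> \oo]
    --> moment (f u) idfun.
  move=> u0; apply: cvg_moment (integrable_mass u0) _ _.
  - by move=> n; exact: continuous_trunc.
  - by move=> n r r0; rewrite ger0_norm ?ge_min ?lexx// le_min ltW/=.
  - move=> r r0; apply: cvg_near_cst; near=> n; apply/min_idPl.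
    have : r <= n%:R by near: n; exact: nbhs_infty_ger.
    by move/le_trans; apply; rewrite ler_nat.
apply: (le_of_cvg_seq (cvg_trunc t t0) (cvg_trunc s s0)) => n.
apply: (@moment_nonincreasing _ n.+1%:R) => //.
- exact: continuous_trunc.
- by move=> r r0; rewrite ge_min lexx orbT andbT le_min ltW/=.
- by move=> r r0; rewrite ge_min lexx.
- by move=> r u r0 u0; exact: trunc_subadd.
Unshelve. all: by end_near. Qed.

(** The initial moments of the tents tend to zero with their width by dominated
    convergence, and a tent moment never exceeds its initial value. *)
Lemma tent_moment_small eta : 0 < eta ->
  exists2 e, 0 < e & forall s, 0 <= s -> moment (f s) (tent e) <= eta.
Proof.
move=> eta0; have e_gt0 n : 0 < n.+1%:R^-1 :> R by rewrite invr_gt0.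
have : moment f0 (tent n.+1%:R^-1) @[n --> \oo] --> moment f0 (cst 0).
  apply: cvg_moment f0_mass _ _.
  - by move=> n; exact: continuous_tent.
  - move=> n r r0; rewrite ger0_norm ?tent_le//.
    by case/andP: (tent_bound (e_gt0 n) r0).
  - move=> r r0; apply: cvg_near_cst; near=> n; apply: tent_eq0.
    rewrite ler_pdivrMr// mulrC -ler_pdivrMr//.
    have : 2 / r <= n%:R by near: n; exact: nbhs_infty_ger.
    by move/le_trans; apply; rewrite ler_nat.
rewrite (_ : moment f0 (cst 0) = 0); last first.
  rewrite /moment (@Rintegral_cst _ _ _ f0) ?mul0r//; exact: measurable_Rstar.
move=> /cvgr_le/(_ _ eta0)[n _ /(_ n (leqnn n)) /= hn].
(* The dissipation estimate with a vanishing lower bound compares with the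
   initial measure directly. *)
exists n.+1%:R^-1 => // s s0.
apply: le_trans hn.
have e0 := e_gt0 n.
have := @moment_dissipation (tent n.+1%:R^-1) n.+1%:R^-1 (@continuous_tent R _)
  (fun r => @tent_bound R _ r e0) (@tent_le R _) 0 (cst 0) 0 s s0.
rewrite mul0r mulr0 addr0; apply => //.
- by move=> r r0; exact: cst_continuous.
- move=> u u0; apply: integrable_radial_sublinear => // r r0.
    exact: cst_continuous.
  by rewrite /= lexx ltW.
- move=> x y xR yR; rewrite mul0r -mulrN mulr_ge0 ?K_ge0// /radial_incr norm1D//.
  have := @tent_subadd R _ _ _ e0 (norm1_gt0 xR) (norm1_gt0 yR); lra.
Unshelve. all: by end_near. Qed.

(** * Loss of mass *)
Variables (c1 h : R).
Hypothesis c1_gt0 : 0 < c1.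
Hypothesis h_gt : 1 / 2 < h.
Hypothesis h_lt1 : h < 1.
Hypothesis K_ge : forall x y, Rstar R d x -> Rstar R d y ->
  c1 * (norm1 x `^ h * norm1 y `^ h) <= K x y.

Definition ramp_power A (r : R) := ramp A r * r `^ h.

Lemma continuous_ramp_power A : continuous_pos (ramp_power A).
Proof.
apply: continuous_posM => r r0; first exact: continuous_ramp.
exact: continuous_powR_gt0.
Qed.

Lemma ramp_power_ge0 A r : 0 <= ramp_power A r.
Proof. by rewrite mulr_ge0 ?ramp_ge0 ?powR_ge0. Qed.

Lemma integrable_ramp_power A s : 0 < A -> 0 <= s ->
  integrable_radial (f s) (ramp_power A).
Proof.
move=> A0 s0.
(* Beyond [A], r^h <= 1 + r and 1 <= r / A. *)
have iM := integrable_radialZ (1 + A^-1) (integrable_mass s0).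
apply: integrable_radial_le (@continuous_ramp_power A) iM _ => r r0.
rewrite ger0_norm ?ramp_power_ge0// /ramp_power /=.
have iA : 0 < A^-1 by rewrite invr_gt0.
have [rA|Ar] := leP r A; first by rewrite ramp_eq0// mul0r mulr_ge0 ?addr_ge0 ?ltW.
apply: (@le_trans _ _ (r `^ h)); first by rewrite ler_piMl ?powR_ge0 ?ramp_le1.
have rA1 : 1 <= A^-1 * r by rewrite mulrC ler_pdivlMr// mul1r ltW.
rewrite mulrDl mul1r; have [r1|r1] := leP 1 r.
  by apply: le_trans (ler1_powR r1 (ltW h_lt1)) _; lra.
have r1h : r `^ h <= 1.
  rewrite -[leRHS](powRr0 r); apply: ger_powR; first by rewrite r0 ltW.
  by have := h_gt; lra.
lra.
Qed.

(** Dissipation of min(r, A): a merger of two clusters larger than [A] lowers the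
    total by exactly [A], and such pairs coagulate at least at the rate
    c1 |x|^h |y|^h. *)
Lemma large_mass_dissipation A m t : 0 < A -> 0 <= t ->
  \int[leb]_(s in `[0, t])
    moment (f s) (fun r => cutoff m r * ramp_power A r) ^+ 2
  <= 2 * moment f0 idfun / (c1 * A).
Proof.
move=> A0 t0; set J := (X in X <= _).
have tA r : 0 < r -> 0 <= Num.min r A <= A.
  by move=> r0; rewrite ge_min lexx orbT andbT le_min !ltW.
have tr r : 0 < r -> Num.min r A <= r by move=> r0; rewrite ge_min lexx.
have H : moment (f t) (fun r => Num.min r A) + 2^-1 * (c1 * A * J) <=
    moment f0 (fun r => Num.min r A).
  apply: (@moment_dissipation _ A) => //.
  - exact: continuous_trunc.
  - exact: continuous_ramp_power.
  - by rewrite ltW// mulr_gt0.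
  - by move=> s s0; exact: integrable_ramp_power.
  move=> x y xR yR; have x0 := norm1_gt0 xR; have y0 := norm1_gt0 yR.
  have K0 := K_ge0 xR yR.
  rewrite -mulrN /radial_incr norm1D//.
  move: (trunc_subadd A0 x0 y0).
  have [xA|Ax] := leP (norm1 x) A => sub.
    by rewrite {1}/ramp_power ramp_eq0// mul0r mulr0 mul0r mulr0 mulr_ge0//; lra.
  move: sub; have [yA|Ay] := leP (norm1 y) A => sub.
    rewrite {2}/ramp_power (ramp_eq0 A0 yA) mul0r !mulr0 mulr_ge0//; lra.
  rewrite (min_idPr _); last by lra.
  rewrite (_ : - (A - A - A) = A); last by ring.
  rewrite (mulrAC c1); apply: ler_wpM2r; first exact: ltW.
  apply: le_trans (K_ge xR yR).
  apply: ler_wpM2l; first exact: ltW.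
  apply: ler_pM.
  - by rewrite mulr_ge0 ?cutoff_ge0 ?ramp_power_ge0.
  - by rewrite mulr_ge0 ?cutoff_ge0 ?ramp_power_ge0.
  - rewrite mulrA ler_piMl ?powR_ge0//.
    by rewrite mulr_ile1 ?cutoff_ge0 ?ramp_ge0 ?cutoff_le1 ?ramp_le1.
  - rewrite mulrA ler_piMl ?powR_ge0//.
    by rewrite mulr_ile1 ?cutoff_ge0 ?ramp_ge0 ?cutoff_le1 ?ramp_le1.
have p0 : 0 <= moment (f t) (fun r => Num.min r A).
  by apply: moment_ge0 => r /tA /andP[].
have pM : moment f0 (fun r => Num.min r A) <= moment f0 idfun.
  apply: le_moment => //; apply: integrable_radial_le f0_mass _.
    exact: continuous_trunc.
  by move=> r r0; have /andP[h0 _] := tA r r0; rewrite ger0_norm ?tr.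
rewrite ler_pdivlMr ?mulr_gt0// mulrC; lra.
Qed.

Lemma cutoff_mass_le_sum e N m s : 0 < e -> 0 <= s -> m.+2%:R <= dyadic e N.+1 ->
  moment (f s) (fun r => cutoff m r * r) <= moment (f s) (tent e) +
    \sum_(k < N) (4 * dyadic e k) `^ (1 - h) *
      moment (f s) (fun r => cutoff m r * ramp_power (dyadic e k) r).
Proof.
move=> e0 s0 mN.
have it : integrable_radial (f s) (tent e).
  apply: integrable_radial_sublinear => // [|r r0]; first exact: continuous_tent.
  by rewrite tent_le// andbT; case/andP: (tent_bound e0 r0).
have ik k : integrable_radial (f s)
    (fun r => cutoff m r * ramp_power (dyadic e k) r).
  apply: integrable_radial_cutoff; first exact: continuous_ramp_power.
  by apply: integrable_ramp_power => //; exact: dyadic_gt0.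
have iwk k := integrable_radialZ ((4 * dyadic e k) `^ (1 - h)) (ik k).
have [iS eS] := @Rintegral_sum_ord _ _ _ (f s) _
  (fun k x => (4 * dyadic e k) `^ (1 - h) *
    (cutoff m (norm1 x) * ramp_power (dyadic e k) (norm1 x)))
  N (@measurable_Rstar R d) iwk.
have {}iS : integrable_radial (f s) (fun r => \sum_(k < N)
    (4 * dyadic e k) `^ (1 - h) * (cutoff m r * ramp_power (dyadic e k) r)).
  exact: iS.
under eq_bigr => k _ do rewrite -momentZ//.
rewrite -[X in _ + X]eS -[X in _ + X]/(moment (f s) (fun r => \sum_(k < N)
    (4 * dyadic e k) `^ (1 - h) * (cutoff m r * ramp_power (dyadic e k) r))).
rewrite -momentD//; apply: le_moment.
- apply: (@integrable_radial_cutoff _ _ _ _ idfun); first exact: continuous_pos_id.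
  exact: integrable_mass.
- exact: integrable_radialD.
move=> r r0; have t0 : 0 <= tent e r by case/andP: (tent_bound e0 r0).
have [rb|rb] := boolP (m.+1%:R^-1 <= r <= m.+2%:R); last first.
  rewrite (cutoff_support rb) mul0r addr_ge0// sumr_ge0// => k _.
  by rewrite mul0r mulr0.
have := @le_dyadic_sum R h e N r (ltW h_lt1) e0 r0.
have rN : r <= dyadic e N.+1 by case/andP: rb => _ /le_trans; apply.
move=> /(_ rN) hr.
apply: le_trans (ler_wpM2l (cutoff_ge0 m r) hr) _.
rewrite mulrDr; apply: lerD; first by rewrite ler_piMl ?cutoff_le1.
by rewrite mulr_sumr; apply: ler_sum => k _; rewrite mulrCA.
Qed.

(** Each scale contributes w_k u_k to the mass, where w_k is the dyadic weight
    and u_k the moment of the ramp.  Young's inequality bounds this by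
    eta p^k + w_k^2 u_k^2 / (4 eta p^k).  The first terms sum to M / 4 by the choice
    of eta; the second ones have, by the dissipation bound, time integrals that
    decay like p^k, so their sum is bounded independently of [t] and of the
    cutoff. *)
Lemma time_cutoff_mass_le : 0 < moment f0 idfun -> exists C, forall m t, 0 <= t ->
  \int[leb]_(s in `[0, t]) moment (f s) (fun r => cutoff m r * r) <=
  t * (moment f0 idfun / 2) + C.
Proof.
set M := moment f0 idfun => M0.
have [e e0 small] := @tent_moment_small (M / 4) ltac:(by rewrite divr_gt0).
have [p [C0 [/andP[p0 p1] C00 wE]]] := dyadic_weight_sqr h_gt e0.
set P := (1 - p)^-1; have P0 : 0 < P by rewrite invr_gt0 subr_gt0.
have sum_le N : \sum_(k < N) p ^+ k <= P by apply: sum_geometric_le; rewrite ltW.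
(* Chosen so that the terms eta p^k sum to at most M / 4. *)
pose eta := M / (4 * P); have eta0 : 0 < eta by rewrite divr_gt0// mulr_gt0.
exists (C0 / (4 * eta) * (2 * M / c1) * P) => m t t0.
have [N mN] := exists_dyadic_ge m.+2%:R e0.
pose u k s := moment (f s) (fun r => cutoff m r * ramp_power (dyadic e k) r).
pose a k := C0 * dyadic e k * p ^+ k / (4 * eta).
have a_ge0 k : 0 <= a k.
  have e4 : 0 < 4 * eta by rewrite mulr_gt0.
  have num : 0 < C0 * dyadic e k * p ^+ k by rewrite !mulr_gt0 ?dyadic_gt0 ?exprn_gt0.
  exact/ltW/divr_gt0.
have iu k : leb.-integrable `[0, t]%classic (EFin \o (fun s => u k s ^+ 2)).
  by apply: integrable_time_sqr_moment; exact: continuous_ramp_power.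
have iau k : leb.-integrable `[0, t]%classic (EFin \o (fun s => a k * u k s ^+ 2)).
  by apply: (integrableZl _ (a k) (iu k)); exact: measurable_itv.
have [iS eS] := @Rintegral_sum_ord _ _ _ leb `[0, t]%classic
  (fun k s => a k * u k s ^+ 2) N (measurable_itv _) iau.
have icst : leb.-integrable `[0, t]%classic (EFin \o cst (M / 2)).
  by apply: (@time_integrable _ `|M / 2|).
apply: (@le_trans _ _ (\int[leb]_(s in `[0, t])
    (M / 2 + \sum_(k < N) a k * u k s ^+ 2))).
  apply: le_Rintegral.
  - exact: measurable_itv.
  - apply: (@time_integrable _ M).
      by apply: (@measurable_moment_cutoff t m idfun); exact: continuous_pos_id.
    move=> s /andP[s0 _]; rewrite ger0_norm; last first.
      by apply: moment_ge0 => r r0; rewrite mulr_ge0 ?cutoff_ge0// ltW.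
    apply: le_trans (mass_moment_le s0); apply: le_moment.
    + apply: (@integrable_radial_cutoff _ _ _ _ idfun); first exact: continuous_pos_id.
      exact: integrable_mass.
    + exact: integrable_mass.
    + by move=> r r0; rewrite ler_piMl ?cutoff_le1// ltW.
  - by apply: (integrableD _ icst iS).
  move=> s; rewrite /= in_itv/= => /andP[s0 _].
  apply: le_trans (cutoff_mass_le_sum e0 s0 mN) _.
  have ineq k : (4 * dyadic e k) `^ (1 - h) * u k s <=
      eta * p ^+ k + a k * u k s ^+ 2.
    set w := _ `^ _; have ww : w ^+ 2 = _ := wE k.
    have pk : 0 < p ^+ k by rewrite exprn_gt0.
    have -> : a k * u k s ^+ 2 = (w * u k s) ^+ 2 / (4 * (eta * p ^+ k)).
      rewrite exprMn ww /a; field; rewrite !gt_eqF//.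
    have q0 : 0 < eta * p ^+ k by rewrite mulr_gt0.
    move: (eta * p ^+ k) (w * u k s) q0 => q z q0.
    (* Young's inequality z <= q + z^2 / (4 q). *)
    rewrite -subr_ge0 (_ : _ - _ = (z - 2 * q) ^+ 2 / (4 * q)); last first.
      by field; rewrite gt_eqF.
    by rewrite divr_ge0 ?sqr_ge0// mulr_ge0// ltW.
  apply: (@le_trans _ _ (M / 4 + \sum_(k < N) (eta * p ^+ k + a k * u k s ^+ 2))).
    by apply: lerD; [exact: small|apply: ler_sum => k _; exact: ineq].
  rewrite big_split/= addrA lerD2r -mulr_sumr.
  have -> : M / 2 = M / 4 + eta * P by rewrite /eta; field; rewrite gt_eqF.
  by rewrite lerD2l; apply: ler_wpM2l (sum_le N); exact: ltW.
rewrite RintegralD//.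
rewrite (@Rintegral_cst _ _ _ leb)//= lebesgue_measure_itv/= eS; apply: lerD.
  case: ifP => _ /=; first by rewrite oppr0 addr0 mulrC.
  by rewrite mulr0 mulr_ge0// divr_ge0// ltW.
apply: (@le_trans _ _ (\sum_(k < N) (C0 / (4 * eta) * (2 * M / c1) * p ^+ k))).
  apply: ler_sum => k _; rewrite (@RintegralZl _ _ _ leb _ _ _ _ (iu k))//.
  have A0 := dyadic_gt0 k e0.
  apply: le_trans (ler_wpM2l (a_ge0 k) (large_mass_dissipation m A0 t0)) _.
  rewrite -/M /a le_eqVlt; apply/orP; left; apply/eqP; field.
  by rewrite !gt_eqF.
rewrite -mulr_sumr; apply: ler_wpM2l (sum_le N).
by apply: mulr_ge0; apply: divr_ge0; apply: ltW => //; exact: mulr_gt0.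
Qed.

Lemma mass_eventually_lost : 0 < moment f0 idfun -> exists2 T, 0 < T &
  forall t, T <= t -> moment (f t) idfun < moment f0 idfun.
Proof.
move=> M0; have [C hC] := time_cutoff_mass_le M0.
set M := moment f0 idfun in M0 hC *.
(* Past 2 |C| / M the bound t M / 2 + C falls below t M. *)
exists (2 * `|C| / M + 1) => [|t tT].
  by rewrite ltr_wpDl// divr_ge0// ?mulr_ge0// ltW.
have t0 : 0 < t by apply: lt_le_trans tT; rewrite ltr_wpDl// divr_ge0// ?mulr_ge0// ltW.
rewrite ltNge; apply/negP => Mt.
have hM : \int[leb]_(s in `[0, t]) moment (f s) idfun <= t * (M / 2) + C.
  apply: (@le_of_cvg_seq R _ (fun=> t * (M / 2) + C)) (cvg_cst _)
    (fun m => hC m t (ltW t0)).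
  apply: (@cvg_time_moment t M idfun).
  - exact: continuous_pos_id.
  - by move=> r /ltW.
  - by move=> s /andP[s0 _]; exact: integrable_mass.
  - by move=> s /andP[s0 _]; exact: mass_moment_le.
have : t * M <= \int[leb]_(s in `[0, t]) moment (f s) idfun.
  have -> : t * M = \int[leb]_(s in `[0, t]) M.
    rewrite (@Rintegral_cst _ _ _ leb)//= lebesgue_measure_itv/= lte_fin t0/=.
    by rewrite oppr0 addr0 mulrC.
  apply: le_Rintegral.
  - exact: measurable_itv.
  - exact: (@time_integrable _ `|M|).
  - apply: (@time_integrable_moment _ M).
    + exact: continuous_pos_id.
    + by move=> s /andP[s0 _]; exact: integrable_mass.
    + move=> s /andP[s0 _]; rewrite ger0_norm ?mass_moment_le//.
      by apply: moment_ge0 => r /ltW.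
  - move=> s; rewrite /= in_itv/= => st; apply: le_trans Mt _.
    exact: mass_nonincreasing.
move=> /le_trans/(_ hM); have CC := ler_norm C.
have : 2 * `|C| < t * M by rewrite -ltr_pdivrMr//; lra.
lra.
Qed.

End WeakSolution.

(** * Bounds on the kernel *)
Lemma powR_le_radial_weight (R : realType) (p q a r : R) : 0 < r ->
  (r <= 1 -> p <= a) -> (1 < r -> a <= q) -> r `^ a <= radial_weight p q r.
Proof.
move=> r0 pa aq; rewrite /radial_weight; have [r1|r1] := leP r 1.
  by rewrite powR1 mulr1; apply: ger_powR; [rewrite r0|exact: pa].
by rewrite powR1 mul1r; apply: ler_powR; [exact: ltW|exact: aq].
Qed.

(** The two terms on the right have product (x y)^a, so the arithmetic-geometric
    mean inequality applies. *)
Lemma powR_sum_ge (R : realType) (a b x y : R) : 0 < x -> 0 < y ->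
  x `^ (a / 2) * y `^ (a / 2) <=
  x `^ (a + b) * y `^ (- b) + y `^ (a + b) * x `^ (- b).
Proof.
move=> x0 y0.
set u := x `^ (a / 2) * _; set v := x `^ (a + b) * _; set w := y `^ (a + b) * _.
have v0 : 0 < v by rewrite mulr_gt0 ?powR_gt0.
have w0 : 0 < w by rewrite mulr_gt0 ?powR_gt0.
have vw : v * w = u ^+ 2.
  have x2 : x `^ (a / 2) ^+ 2 = x `^ (a + b) * x `^ (- b).
    rewrite -powR_mulrn ?powR_ge0// -powRrM -powRD ?(gt_eqF x0) ?implybT//.
    by congr (_ `^ _); field.
  have y2 : y `^ (a / 2) ^+ 2 = y `^ (a + b) * y `^ (- b).
    rewrite -powR_mulrn ?powR_ge0// -powRrM -powRD ?(gt_eqF y0) ?implybT//.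
    by congr (_ `^ _); field.
  by rewrite /u exprMn x2 y2 /v /w; ring.
rewrite leNgt; apply/negP => vwu; nra.
Qed.

(** Every exponent in the upper bound lies on the side of the corresponding
    exponent of the weight that makes the power smaller than the weight.  When
    both sizes exceed 1 this is where - lambda2 <= gamma2 + lambda2 enters. *)
Lemma kernel_le_weight (R : realType) (d : nat) (K : 'rV[R]_d -> 'rV[R]_d -> R)
  (c2 beta gamma1 gamma2 lambda1 lambda2 : R) :
  (forall x y, Rstar R d x -> Rstar R d y -> K x y = K y x) -> 0 < c2 ->
  - lambda2 <= gamma2 + lambda2 ->
  (forall x y, Rstar R d x -> Rstar R d y -> norm1 y <= norm1 x ->
    [/\ norm1 x <= 1 -> norm1 y <= 1 ->
          K x y <= c2 * (norm1 x `^ (- beta) * norm1 y `^ (- beta)),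
        1 <= norm1 x -> norm1 y <= 1 ->
          K x y <=
            c2 * (norm1 x `^ (gamma1 + lambda1) * norm1 y `^ (- lambda1)) &
        1 <= norm1 x -> 1 <= norm1 y ->
          K x y <=
            c2 * (norm1 x `^ (gamma2 + lambda2) * norm1 y `^ (- lambda2))]) ->
  let W := radial_weight (Num.min (- beta) (- lambda1))
             (Num.max (gamma1 + lambda1) (gamma2 + lambda2)) in
  forall x y, Rstar R d x -> Rstar R d y ->
    K x y <= c2 * (W (norm1 x) * W (norm1 y)).
Proof.
move=> K_sym c2_gt0 par2 K_upper W x y.
wlog yx : x y / norm1 y <= norm1 x => [th xR yR|xR yR].
  have [yx|/ltW xy] := leP (norm1 y) (norm1 x); first exact: th.
  by rewrite K_sym// [W _ * _]mulrC; exact: th.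
have x0 := norm1_gt0 xR; have y0 := norm1_gt0 yR.
have [K1 K2 K3] := K_upper x y xR yR yx.
have weigh (a b : R) : K x y <= c2 * (norm1 x `^ a * norm1 y `^ b) ->
    norm1 x `^ a <= W (norm1 x) -> norm1 y `^ b <= W (norm1 y) ->
    K x y <= c2 * (W (norm1 x) * W (norm1 y)).
  move=> /le_trans h xa yb; apply: h; apply: ler_wpM2l; first exact: ltW.
  by apply: ler_pM; rewrite ?powR_ge0.
have min1 : Num.min (- beta) (- lambda1) <= - beta by rewrite ge_min lexx.
have min2 : Num.min (- beta) (- lambda1) <= - lambda1 by rewrite ge_min lexx orbT.
have max1 : gamma1 + lambda1 <= Num.max (gamma1 + lambda1) (gamma2 + lambda2).
  by rewrite le_max lexx.
have max2 : gamma2 + lambda2 <= Num.max (gamma1 + lambda1) (gamma2 + lambda2).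
  by rewrite le_max lexx orbT.
have [x1|x1] := leP (norm1 x) 1.
  have y1 := le_trans yx x1.
  by apply: (weigh _ _ (K1 x1 y1)); apply: powR_le_radial_weight => // h; lra.
have [y1|y1] := leP (norm1 y) 1.
  by apply: (weigh _ _ (K2 (ltW x1) y1)); apply: powR_le_radial_weight => // h; lra.
by apply: (weigh _ _ (K3 (ltW x1) (ltW y1))); apply: powR_le_radial_weight => // h; lra.
Qed.

Theorem theorem1p4 (R : realType) (d : nat) (d_ge1 : (1 <= d)%N)
  (K : 'rV[R]_d -> 'rV[R]_d -> R)
  (K_ge0 : forall x y, Rstar R d x -> Rstar R d y -> 0 <= K x y)
  (K_cont : {within Rstar R d `*` Rstar R d, continuous (fun z => K z.1 z.2)})
  (K_sym : forall x y, Rstar R d x -> Rstar R d y -> K x y = K y x)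
  (c2 beta gamma1 gamma2 lambda1 lambda2 : R)
  (c2_gt0 : 0 < c2)
  (par1 : - lambda1 <= gamma1 + lambda1) (par1' : gamma1 + lambda1 <= 1)
  (par2 : - lambda2 <= gamma2 + lambda2) (par2' : gamma2 + lambda2 <= 1)
  (K_upper : forall x y, Rstar R d x -> Rstar R d y -> norm1 y <= norm1 x ->
    [/\ norm1 x <= 1 -> norm1 y <= 1 ->
          K x y <= c2 * (norm1 x `^ (- beta) * norm1 y `^ (- beta)),
        1 <= norm1 x -> norm1 y <= 1 ->
          K x y <=
            c2 * (norm1 x `^ (gamma1 + lambda1) * norm1 y `^ (- lambda1)) &
        1 <= norm1 x -> 1 <= norm1 y ->
          K x y <=
            c2 * (norm1 x `^ (gamma2 + lambda2) * norm1 y `^ (- lambda2))])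
  (c1 gamma_gel lambda_gel : R)
  (c1_gt0 : 0 < c1) (gel_gt1 : 1 < gamma_gel) (gel_lt2 : gamma_gel < 2)
  (par_gel : - lambda_gel <= gamma_gel + lambda_gel)
  (K_lower : forall x y, Rstar R d x -> Rstar R d y ->
    c1 * (norm1 x `^ (gamma_gel + lambda_gel) * norm1 y `^ (- lambda_gel) +
          norm1 y `^ (gamma_gel + lambda_gel) * norm1 x `^ (- lambda_gel))
      <= K x y)
  (f0 : {measure set (borelRd R d) -> \bar R})
  (f0_radon : radon_Rstar f0)
  (f0_moments :
    (\int[f0]_(x in Rstar R d) (norm1 x)%:E +
     \int[f0]_(x in Rstar R d)
       (weight beta gamma1 gamma2 lambda1 lambda2 x)%:E < +oo)%E)
  (f : R -> {measure set (borelRd R d) -> \bar R})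
  (f_sol :
    weak_solution K (weight beta gamma1 gamma2 lambda1 lambda2) f0 f)
  (f0_neq0 : (\int[f0]_(x in Rstar R d) (norm1 x)%:E)%E <> 0%E) :
  exists T : R, 0 < T /\ forall t : R, T <= t ->
    (\int[f t]_(x in Rstar R d) (norm1 x)%:E
       < \int[f0]_(x in Rstar R d) (norm1 x)%:E)%E.
Proof.
pose W := radial_weight (Num.min (- beta) (- lambda1))
            (Num.max (gamma1 + lambda1) (gamma2 + lambda2)).
have weightW : weight beta gamma1 gamma2 lambda1 lambda2 =
    (fun x : 'rV[R]_d => W (norm1 x)).
  by apply/funext => x; exact: weightE.
rewrite weightW in f0_moments f_sol.
have W_gt0 r : 0 < r -> 0 < W r by exact: radial_weight_gt0.
have f0_mass : integrable_radial f0 idfun.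
  apply: integrable_radialP; first exact: continuous_pos_id.
    by move=> r /ltW.
  apply: le_lt_trans f0_moments; rewrite -[leLHS]adde0 leeD2l//.
  by apply: integral_ge0 => x /norm1_gt0 /W_gt0 /ltW; rewrite lee_fin.
have M_gt0 : 0 < moment f0 idfun.
  rewrite lt_neqAle moment_ge0 ?andbT; last by move=> r /ltW.
  apply/eqP => M0; apply: f0_neq0.
  by have := EFin_moment f0_mass => /= <-; rewrite -M0.
have [T T_gt0 hT] := @mass_eventually_lost R d K W f0 f W_gt0
  (@continuous_radial_weight _ _ _) f_sol f0_mass c2 (ltW c2_gt0) K_ge0
  (kernel_le_weight K_sym c2_gt0 par2 K_upper) c1 (gamma_gel / 2) c1_gt0
  ltac:(lra) ltac:(lra)
  (fun x y xR yR => le_trans (ler_wpM2l (ltW c1_gt0)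
     (powR_sum_ge gamma_gel lambda_gel (norm1_gt0 xR) (norm1_gt0 yR)))
     (K_lower x y xR yR)) M_gt0.
exists T; split => // t Tt; have t_ge0 : 0 <= t by exact: le_trans (ltW T_gt0) Tt.
have := hT t Tt; rewrite -lte_fin !EFin_moment//.
exact: (integrable_mass f_sol f0_mass).
Qed.
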